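(* Assume the standing setting. Let $W(x,\lambda)$ be the fundamental solution of the canonical system $$w'(x,\lambda)=\mathrm{i}\lambda JH(x)w(x,\lambda),\qquad H(x)=\beta(x)^*\beta(x),$$ normalised by $W(0,\lambda)=I_{2p}$. Then for $0<\ell\le r$ and all $\lambda\neq0$ for which the right-hand side is defined, $$W(\ell,\lambda)=w_A(\ell,1/\lambda).$$ If the hypotheses hold on $[0,r]$ for every $r>0$, then this representation holds for every $\ell\in(0,\infty)$.
   Context: Standing setting. Let $p\in\mathbb N$, $r>0$, and $J=\begin{bmatrix}0&I_p\\ I_p&0\end{bmatrix}$. For $q\in\mathbb N$, $\mathcal U^{p\times q}[0,r]$ is the class of $p\times q$ matrix functions $\mathcal G$ on $[0,r]$ that are differentiable and satisfy $\mathcal G'(x)=\mathcal G'(0)+\int_0^x\mathcal G''(t)\,dt$ for some $\mathcal G''\in L_2^{p\times q}(0,r)$. We write $\mathcal U^p[0,r]:=\mathcal U^{p\times1}[0,r]$. Let $\beta\in\mathcal U^{p\times 2p}[0,r]$ satisfy $\beta(x)J\beta(x)^*\equiv0$ and $\beta'(x)J\beta(x)^*\equiv \mathrm{i} I_p$. Write $\beta=\begin{bmatrix}\beta_1&\beta_2\end{bmatrix}$ with $p\times p$ blocks, and assume $\det\beta_2(0)\ne0$. On $L_2^p(0,r)$ define $(Af)(x)=\int_0^x(t-x)f(t)\,dt$ and $(Kf)(x)=\mathrm{i}\beta(x)J\int_0^x\beta(t)^*f(t)\,dt$. Let $E$ be a bounded operator on $L_2^p(0,r)$ with bounded inverse,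 of the form $(Ef)(x)=u(x)\beta_2(0)f(x)+\int_0^x\mathcal E(x,t)f(t)\,dt$, where $u\in\mathcal U^{p\times p}[0,r]$ is unitary-valued with $u(0)=I_p$. Assume $K=EAE^{-1}$ and $E^{-1}\beta_2\equiv I_p$ (applied columnwise). Such an $E$ exists. Set $S=E^{-1}(E^* )^{-1}$. Define $\Pi:\mathbb C^{2p}\to L_2^p(0,r)$ by $\Pi h=\Pi(x)h$, where $\Pi(x):=(E^{-1}\beta)(x)$. For $0<\ell\le r$, let $P_\ell:L_2^p(0,r)\to L_2^p(0,\ell)$ be restriction. Set $S_\ell=P_\ell SP_\ell^*$, $A_\ell=P_\ell AP_\ell^*$, and $\Pi_\ell=P_\ell\Pi$. The transfer matrix function is $$w_A(\ell,\lambda)=I_{2p}-\mathrm{i} J\Pi_\ell^*S_\ell^{-1}(A_\ell-\lambda I)^{-1}\Pi_\ell .$$ *)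

(* Defs.v *)
From HB Require Import structures.
From mathcomp Require Import all_boot all_order all_algebra.
From mathcomp Require Import all_classical all_reals all_analysis.
From mathcomp.real_closed Require Import complex.
Set Implicit Arguments. Unset Strict Implicit. Unset Printing Implicit Defensive.
Import Order.TTheory GRing.Theory Num.Theory.
Import numFieldNormedType.Exports.
Local Open Scope classical_set_scope.
Local Open Scope ring_scope.

Section Defs.
Variable R : realType.
Local Notation C := (R[i]).
Local Notation mu := (@lebesgue_measure R).

Definition iC : C := Complex 0 1.

Definition cre (z : C) : R := complex.Re z.
Definition cim (z : C) : R := complex.Im z.

Definition cabs2 (z : C) : R := cre z ^+ 2 + cim z ^+ 2.

Definition cint (a b : R) (g : R -> C) : C :=
  Complex (Rintegral mu `[a, b] (fun t => cre (g t)))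
          (Rintegral mu `[a, b] (fun t => cim (g t))).

Definition cintmx m n (a b : R) (G : R -> 'M[C]_(m, n)) : 'M[C]_(m, n) :=
  \matrix_(i, j) cint a b (fun t => G t i j).

Definition mxadj m n (M : 'M[C]_(m, n)) : 'M[C]_(n, m) := (map_mx (@conjc R) M)^T.

Definition Jmx p : 'M[C]_(p + p) := block_mx 0 1%:M 1%:M 0.

(** C^m-valued functions on the line (only their values on [0,l] matter) *)
Definition fn m := R -> 'cV[C]_m.

Definition L2c (l : R) (g : R -> C) : Prop :=
  measurable_fun `[0, l] (fun x => cre (g x)) /\
  measurable_fun `[0, l] (fun x => cim (g x)) /\
  mu.-integrable `[0, l] (fun x => (cabs2 (g x))%:E).

Definition inL2 m (l : R) (f : fn m) : Prop := forall i, L2c l (fun x => f x i 0).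

Definition nrm2 m (l : R) (f : fn m) : R :=
  \sum_(i < m) Rintegral mu `[0, l] (fun x => cabs2 (f x i 0)).

Definition ip m (l : R) (f g : fn m) : C := cint 0 l (fun x => (mxadj (g x) *m f x) 0 0).

Definition aeeq m (l : R) (f g : fn m) : Prop :=
  {ae mu, forall x, 0 <= x <= l -> f x = g x}.

Definition bounded_op m (l : R) (T : fn m -> fn m) : Prop :=
  (forall f, inL2 l f -> inL2 l (T f)) /\
  (forall f g, inL2 l f -> inL2 l g -> aeeq l f g -> aeeq l (T f) (T g)) /\
  (forall (a : C) f g, inL2 l f -> inL2 l g ->
      aeeq l (T (fun x => a *: f x + g x)) (fun x => a *: T f x + T g x)) /\
  (exists M : R, forall f, inL2 l f -> nrm2 l (T f) <= M * nrm2 l f).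

Definition inverse_on m (l : R) (T Ti : fn m -> fn m) : Prop :=
  (forall f, inL2 l f -> inL2 l (Ti f)) /\
  (forall f g, inL2 l f -> inL2 l g -> aeeq l f g -> aeeq l (Ti f) (Ti g)) /\
  (forall f, inL2 l f -> aeeq l (T (Ti f)) f /\ aeeq l (Ti (T f)) f).

Definition adjoint_on m (l : R) (T Ts : fn m -> fn m) : Prop :=
  (forall g, inL2 l g -> inL2 l (Ts g)) /\
  (forall f g, inL2 l f -> inL2 l g -> ip l (T f) g = ip l f (Ts g)).

(** G1 is the derivative of G on [0,l] (one-sided at the endpoints),
    entrywise for real and imaginary parts *)
Definition deriv_on m n (l : R) (G G1 : R -> 'M[C]_(m, n)) : Prop :=
  forall x, 0 <= x <= l -> forall i j,
    ((fun y => (y - x)^-1 * (cre (G y i j) - cre (G x i j)))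
        @ within [set y | 0 <= y <= l] x^' --> cre (G1 x i j)) /\
    ((fun y => (y - x)^-1 * (cim (G y i j) - cim (G x i j)))
        @ within [set y | 0 <= y <= l] x^' --> cim (G1 x i j)).

Definition classU m n (l : R) (G G1 : R -> 'M[C]_(m, n)) : Prop :=
  deriv_on l G G1 /\
  exists G2 : R -> 'M[C]_(m, n),
    (forall i j, L2c l (fun x => G2 x i j)) /\
    (forall x, 0 <= x <= l -> G1 x = G1 0 + cintmx 0 x G2).

Definition colfn m n (G : R -> 'M[C]_(m, n)) (k : 'I_n) : fn m := fun x => col k (G x).

Definition blk2 p (b : R -> 'M[C]_(p, p + p)) : R -> 'M[C]_p := fun x => rsubmx (b x).

Definition Aop p (f : fn p) : fn p :=
  fun x => cintmx 0 x (fun t => (t - x)%:C%C *: f t).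

Definition Kop p (b : R -> 'M[C]_(p, p + p)) (f : fn p) : fn p :=
  fun x => iC *: (b x *m Jmx p *m cintmx 0 x (fun t => mxadj (b t) *m f t)).

Definition Eop p (u : R -> 'M[C]_p) (b : R -> 'M[C]_(p, p + p))
    (Ek : R -> R -> 'M[C]_p) (f : fn p) : fn p :=
  fun x => u x *m blk2 b 0 *m f x + cintmx 0 x (fun t => Ek x t *m f t).

Definition ext p (l : R) (f : fn p) : fn p := fun x => if (0 <= x <= l) then f x else 0.

Definition colsmx p n (F : 'I_n -> fn p) : R -> 'M[C]_(p, n) :=
  fun x => \matrix_(i, k) F k x i 0.

Definition kernel_ok p (l : R) (Ek : R -> R -> 'M[C]_p) : Prop :=
  forall f : fn p, inL2 l f ->
    {ae mu, forall x, 0 <= x <= l -> forall i,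
       mu.-integrable `[0, x] (fun t => (cre ((Ek x t *m f t) i 0))%:E) /       mu.-integrable `[0, x] (fun t => (cim ((Ek x t *m f t) i 0))%:E)}.

End Defs.

(* Main.v *)
Require Import Defs.
From HB Require Import structures.
From mathcomp Require Import all_boot all_order all_algebra.
From mathcomp Require Import all_classical all_reals all_analysis.
From mathcomp Require Import measurable_realfun ring lra.
From mathcomp.real_closed Require Import complex.
Import Order.TTheory GRing.Theory Num.Theory.
Import numFieldNormedType.Exports.
Local Open Scope classical_set_scope.
Local Open Scope ring_scope.

(**
Let [E_l] be the compression of [E] to [0, l].  If [E] and its inverse are both
lower triangular, then [S_l^-1 = E_l^* E_l], [E_l Pi_l = beta] and
[E_l A_l E_l^-1 = K_l], so the transfer function is
[1 - i J beta^* (K_l - 1/lam)^-1 beta].  The equation [(K - 1/lam) g = beta e_k]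
says that [y x = e_k - i J int_0^x beta^* g] satisfies [g = - lam beta y], hence
[y' = i lam J beta^* beta y] and [y = W e_k]; uniqueness comes from the constancy
of [W(x, conj lam)^* J y].

The kernel of [E] is only assumed to define a bounded operator, and this does not
make the inverse of [E] lower triangular: that has to be extracted from
[K = E A E^-1].  If [g] is bounded and vanishes on [0, l], then so does [K^n g], and
the estimate [i beta(x) J beta(t)^* = - (x - t) (1 + o(1))] gives
[K^n g = O(theta^n (x - l)^(2n) / (2n)!)] for every [theta > 1].  Since
[A^n E^-1 g = E^-1 K^n g], the moments [int_0^r (r - t)^(2n+1) f] of [f = E^-1 g] are
[O(rho^(2n))] for every [rho > r - l], which forces [f = 0] on [0, l].
*)

(** The growth rate of [K^n g] has to be sharp. A bound of the kernel by [M (x - t)] alone would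
    give [f = 0] only on [[0, r - sqrt M (r - l)]], which loses part of [[0, l]] as soon as [M > 1].
    So the leading part [-(x - t)] is kept exact. The remainder, controlled by the square-integrable
    second derivative of [beta], splits into a part with an arbitrarily small coefficient and a part
    with one more factor [x - t]. The latter costs only [O(1/n)] at step [n], and the product of the
    factors [1 + O(1/n)] grows polynomially.

    Each application of [A] raises the order of a moment by two, so only every second moment of [f]
    is controlled; this is why the test functions are polynomials in [(r - t)^2].

    Triangularity of [E] can be read off its formula. That of its inverse is applied to the columns
    of [beta]: cut off at [l], they leave a bounded tail, which is the kind of [g] that the growth
    estimate covers. *)

Set Implicit Arguments.
Unset Strict Implicit.
Unset Printing Implicit Defensive.

(** * Integrability and estimates on compact real intervals *)

Section RealIntegrals.
Variable R : realType.
Local Notation mu := (@lebesgue_measure R).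
Local Notation intg a b f := (mu.-integrable `[a, b] (EFin \o f)).

Lemma measurable_cc (a b : R) : measurable (`[a, b] : set (measurableTypeR R)).
Proof. exact: measurable_itv. Qed.

Lemma ae_imp (P Q : R -> Prop) : (forall x, P x -> Q x) ->
  {ae mu, forall x, P x} -> {ae mu, forall x, Q x}.
Proof. by move=> PQ; apply: (@filterS _ _ (ae_filter_ringOfSetsType mu)). Qed.

Lemma ae_and (P Q : R -> Prop) :
  {ae mu, forall x, P x} -> {ae mu, forall x, Q x} -> {ae mu, forall x, P x /\ Q x}.
Proof. exact: (@filterI _ _ (ae_filter_ringOfSetsType mu)). Qed.

Lemma Rintegral_cvg (D : set R) (f_ : nat -> R -> R) (f g : R -> R) :
  measurable D -> (forall n, measurable_fun D (f_ n)) -> measurable_fun D f ->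
  {ae mu, forall x, D x -> f_ ^~ x @ \oo --> f x} ->
  mu.-integrable D (EFin \o g) ->
  (forall n x, D x -> `|f_ n x| <= g x) ->
  (fun n => Rintegral mu D (f_ n)) @ \oo --> Rintegral mu D f.
Proof.
move=> mD mf_ mf f_f ig f_g.
have [|||||fi _] := @dominated_convergence _ _ _ mu D mD
  (fun n => EFin \o f_ n) (EFin \o f) (EFin \o g).
- by move=> n; apply/measurable_EFinP; exact: mf_.
- exact/measurable_EFinP.
- by apply: ae_imp f_f => x h Dx; apply: cvg_EFin (h Dx); exact: nearW.
- exact: ig.
- by apply: aeW => x n Dx /=; rewrite lee_fin f_g.
move=> h; apply: fine_cvg; rewrite fineK //.
apply: integrable_fin_num => //.
Qed.

Lemma continuous_intg (a b : R) (f : R -> R) :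
  {within `[a, b], continuous f} -> intg a b f.
Proof. by move=> cf; apply: continuous_compact_integrable => //; exact: segment_compact. Qed.

Lemma intg_sub (a b c d : R) (f : R -> R) : a <= c -> d <= b ->
  intg a b f -> intg c d f.
Proof.
move=> ac db; apply: integrableS => //.
by apply: subset_itv; rewrite bnd_simp.
Qed.

Lemma continuous_bound (a b : R) (f : R -> R) :
  {within `[a, b], continuous f} ->
  exists2 M, 0 <= M & forall x, a <= x <= b -> `|f x| <= M.
Proof.
move=> cf; have [M [Mr HM]] := compact_bounded (continuous_compact cf (@segment_compact R a b)).
exists (`|M| + 1) => [|x xab]; first by rewrite addr_ge0.
apply: (HM (`|M| + 1)).
  by rewrite (le_lt_trans (ler_norm _))// ltrDl.
by exists x => //=; rewrite in_itv.
Qed.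

Lemma intgM (a b : R) (f h : R -> R) (M : R) :
  measurable_fun `[a, b] h -> (forall x, a <= x <= b -> `|h x| <= M) ->
  intg a b f -> intg a b (fun x => h x * f x).
Proof.
move=> mh hM fi; have mf := measurable_int _ fi.
have Mi := integrableZl (measurable_cc a b) M fi.
apply: (@le_integrable _ _ _ mu `[a, b] (measurable_cc a b) _ _ _ _ Mi).
  by apply/measurable_EFinP; apply: measurable_funM => //; exact/measurable_EFinP.
move=> x /=; rewrite in_itv/= => xab; rewrite lee_fin normrM.
have hx := hM x xab; rewrite [leRHS]normrM ler_wpM2r//.
by rewrite (le_trans hx) ?ler_norm.
Qed.

Lemma intg_measurable (a b : R) (f : R -> R) : intg a b f -> measurable_fun `[a, b] f.
Proof. by move/measurable_int/measurable_EFinP. Qed.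

Lemma intgMc (a b : R) (f h : R -> R) :
  {within `[a, b], continuous h} -> intg a b f -> intg a b (fun x => h x * f x).
Proof.
move=> ch fi; have [M _ hM] := continuous_bound ch.
exact: (intgM (intg_measurable (continuous_intg ch)) hM).
Qed.

Lemma intgZ (a b c : R) (f : R -> R) : intg a b f -> intg a b (fun x => c * f x).
Proof. by move/(integrableZl (measurable_cc a b) c). Qed.

Lemma intgD (a b : R) (f g : R -> R) : intg a b f -> intg a b g ->
  intg a b (fun x => f x + g x).
Proof. by move=> /(integrableD (measurable_cc a b)) /[apply]. Qed.

Lemma intgB (a b : R) (f g : R -> R) : intg a b f -> intg a b g ->
  intg a b (fun x => f x - g x).
Proof. by move=> /(integrableB (measurable_cc a b)) /[apply]. Qed.

Lemma Rintegral_bound (a b : R) (f g : R -> R) :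
  intg a b f -> intg a b g -> (forall x, a <= x <= b -> `|f x| <= g x) ->
  `|\int[mu]_(x in `[a, b]) f x| <= \int[mu]_(x in `[a, b]) g x.
Proof.
move=> fi gi fg; apply: (le_trans (le_normr_Rintegral _ fi)) => //.
apply: le_Rintegral => //; first exact: integrable_norm.
Qed.

End RealIntegrals.

(** * A function with geometrically small moments vanishes near 0; Fubini on a triangle *)

Section Moments.
Variable R : realType.
Local Notation mu := (@lebesgue_measure R).
Local Notation intg a b f := (mu.-integrable `[a, b] (EFin \o f)).

Lemma Rintegral_sum_ord (a b : R) (n : nat) (f : 'I_n -> R -> R) :
  (forall i, intg a b (f i)) ->
  intg a b (fun x => \sum_(i < n) f i x) /\
  \int[mu]_(x in `[a, b]) (\sum_(i < n) f i x) =
    \sum_(i < n) \int[mu]_(x in `[a, b]) f i x.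
Proof.
elim: n f => [|n IH] f fi.
  split; last by under eq_Rintegral do rewrite big_ord0; rewrite Rintegral_cst// mul0r big_ord0.
  have -> : (fun x => \sum_(i < 0) f i x) = cst 0.
    by apply/funext => x; rewrite big_ord0.
  exact: integrable0.
have [i1 e1] := IH (fun i => f (widen_ord (leqnSn n) i)) (fun i => fi _).
split.
  have -> : (fun x => \sum_(i < n.+1) f i x) =
    (fun x => \sum_(i < n) f (widen_ord (leqnSn n) i) x + f ord_max x).
    by apply/funext => x; rewrite big_ord_recr.
  exact: intgD.
under eq_Rintegral do rewrite big_ord_recr/=.
by rewrite RintegralD// e1 big_ord_recr.
Qed.

Lemma bernoulli_le (y : R) (M : nat) : 0 <= y <= 1 -> 1 - M%:R * y <= (1 - y) ^+ M.
Proof.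
move=> /andP[y0 y1]; elim: M => [|M IH]; first by rewrite mul0r subr0 expr0.
rewrite exprS; have h : (1 - y) * (1 - M%:R * y) <= (1 - y) * (1 - y) ^+ M.
  by rewrite ler_wpM2l// subr_ge0.
apply: le_trans h; rewrite -natr1.
have : 0 <= M%:R * y ^+ 2 by rewrite mulr_ge0// ?ler0n// sqr_ge0.
lra.
Qed.

Lemma expr_1Dx_le (y : R) (M : nat) : 0 <= 1 + y -> (1 + y) ^+ M <= expR (M%:R * y).
Proof.
move=> y0; rewrite mulrC expRM_natr lerXn2r// ?nnegrE ?expR_ge0//.
exact: expR_ge1Dx.
Qed.

Lemma continuousX (f : R -> R) n : continuous f -> continuous (fun t => f t ^+ n).
Proof.
move=> cf t; elim: n => [|n IH]; first exact: cvg_cst.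
have -> : (fun t => f t ^+ n.+1) = (fun t => f t * f t ^+ n).
  by apply/funext => s; rewrite exprS.
by apply: cvgM; [exact: cf|exact: IH].
Qed.

Section test.
Variables (r c : R) (b : nat).
Hypotheses (c0 : 0 < c) (b0 : (0 < b)%N) (rbc : r <= b%:R * c).

(** Polynomials in [(r - t)^2] with values in [0, 1] that converge to the indicator of
    [t < r - c].  The absolute values of their coefficients, weighted by the powers of
    [rho], add up to [(1 + (rho / (b c))^(2N))^(b^(2N)) - 1], which tends to 0 when
    [rho < c]. *)
Definition step_poly (N : nat) (t : R) : R :=
  1 - (1 - ((r - t) / (b%:R * c)) ^+ (N.*2)) ^+ (b ^ N.*2)%N.

Let bc0 : 0 < b%:R * c. Proof. by rewrite mulr_gt0// ltr0n. Qed.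

Lemma step_poly_arg N t : 0 <= t <= r -> 0 <= ((r - t) / (b%:R * c)) ^+ (N.*2) <= 1.
Proof.
move=> /andP[t0 tr]; have h0 : 0 <= (r - t) / (b%:R * c).
  by rewrite divr_ge0 ?subr_ge0// ltW.
rewrite exprn_ge0//= exprn_ile1// ler_pdivrMr// mul1r.
by rewrite (le_trans _ rbc)// gerBl.
Qed.

Lemma step_poly_bound N t : 0 <= t <= r -> `|step_poly N t| <= 1.
Proof.
move=> /(step_poly_arg N)/andP[y0 y1]; rewrite /step_poly.
set y := _ ^+ _ in y0 y1 *.
have z0 : 0 <= (1 - y) ^+ (b ^ N.*2)%N by rewrite exprn_ge0// subr_ge0.
have z1 : (1 - y) ^+ (b ^ N.*2)%N <= 1 by rewrite exprn_ile1 ?subr_ge0// gerBl.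
by rewrite ger0_norm; lra.
Qed.

(** The exponent [b^(2N)] undoes the normalisation by [b]: the product is [((r - t) / c)^(2N)],
    which tends to 0 or to infinity according to the side of [r - c] on which [t] lies. *)
Lemma step_poly_scale N t : (b ^ N.*2)%N%:R * ((r - t) / (b%:R * c)) ^+ (N.*2) =
  ((r - t) / c) ^+ N.*2.
Proof.
rewrite natrX -exprMn; congr (_ ^+ _); field.
by rewrite gt_eqF// pnatr_eq0 -lt0n b0.
Qed.

Lemma cvg_even (q : R) : 0 <= q < 1 -> (fun N : nat => q ^+ N.*2) @ \oo --> (0 : R).
Proof.
move=> /andP[q0 q1].
have -> : (fun N : nat => q ^+ N.*2) = (fun N => (q ^+ 2) ^+ N).
  by apply/funext => N; rewrite -exprM mul2n.
by apply: cvg_expr; rewrite ger0_norm ?exprn_ge0// exprn_ilt1.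
Qed.

(** Bernoulli's inequality bounds [step_poly] by [((r - t) / c)^(2N)], and here the base is below
    1. *)
Lemma step_poly_cvg0 t : 0 <= t <= r -> r - c < t -> step_poly ^~ t @ \oo --> (0 : R).
Proof.
move=> tr ct; apply: (@squeeze_cvgr _ _ _ _ (cst 0) (fun N => ((r - t) / c) ^+ N.*2)).
- apply: nearW => N /=; have /andP[y0 y1] := step_poly_arg N tr.
  rewrite /step_poly -step_poly_scale; set y := _ ^+ _ in y0 y1 *.
  have y01 : 0 <= y <= 1 by rewrite y0.
  have := bernoulli_le (b ^ N.*2) y01.
  have z1 : (1 - y) ^+ (b ^ N.*2)%N <= 1 by rewrite exprn_ile1 ?subr_ge0// gerBl.
  by move=> h; rewrite subr_ge0 z1/= lerBlDr -lerBlDl.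
- exact: cvg_cst.
- apply: cvg_even; case/andP: tr => t0 tr.
  apply/andP; split; first by rewrite divr_ge0 ?subr_ge0// ltW.
  by rewrite ltr_pdivrMr// mul1r; lra.
Qed.

(** With [X = ((r - t) / c)^(2N)], now unbounded in [N], the distance to 1 is at most
    [exp (- X) <= 1 / X]. *)
Lemma step_poly_cvg1 t : 0 <= t <= r -> t < r - c -> step_poly ^~ t @ \oo --> (1 : R).
Proof.
move=> tr ct; have rt : c < r - t by lra.
have rt0 : 0 < r - t by exact: lt_trans rt.
apply: (@squeeze_cvgr _ _ _ _ (fun N => 1 - (c / (r - t)) ^+ N.*2) (cst 1)).
- apply: nearW => N /=; have /andP[y0 y1] := step_poly_arg N tr.
  rewrite /step_poly; have := step_poly_scale N t; set y := _ ^+ _ in y0 y1 * => hy.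
  have z0 : 0 <= (1 - y) ^+ (b ^ N.*2)%N by rewrite exprn_ge0// subr_ge0.
  rewrite gerBl z0 andbT lerD2l lerN2.
  have : (1 - y) ^+ (b ^ N.*2)%N <= expR ((b ^ N.*2)%N%:R * - y).
    by apply: expr_1Dx_le; rewrite subr_ge0.
  move=> /le_trans; apply; rewrite mulrN hy expRN.
  rewrite -[c / _]invf_div exprVn lef_pV2 ?posrE ?expR_gt0 ?exprn_gt0 ?divr_gt0//.
  by apply: le_trans (expR_ge1Dx _); rewrite lerDr.
- rewrite -[X in _ --> X]subr0; apply: cvgB; first exact: cvg_cst.
  apply: cvg_even; apply/andP; split; first by rewrite divr_ge0// ltW.
  by rewrite ltr_pdivrMr// mul1r.
- exact: cvg_cst.
Qed.

Lemma continuous_step_poly N : continuous (step_poly N).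
Proof.
move=> t; rewrite /step_poly; apply: cvgB; first exact: cvg_cst.
apply: (@continuousX (fun t => 1 - ((r - t) / (b%:R * c)) ^+ N.*2)) => {}t.
apply: cvgB; first exact: cvg_cst.
apply: (@continuousX (fun t => (r - t) / (b%:R * c))) => {}t.
by apply: cvgM; [apply: cvgB; [exact: cvg_cst|exact: cvg_id]|exact: cvg_cst].
Qed.

(** The constant term of the binomial expansion cancels the leading 1. Without this cancellation the
    weighted sum of the coefficients would not tend to 0. *)
Lemma step_polyE N t : step_poly N t = \sum_(i < b ^ N.*2)
  - (-1) ^+ i.+1 * 'C(b ^ N.*2, i.+1)%:R / (b%:R * c) ^+ (N * i.+1).*2 * (r - t) ^+ (N * i.+1).*2.
Proof.
rewrite /step_poly exprDn big_ord_recl/= !expr1n mulr1 bin0 mulr1n.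
rewrite opprD addrA subrr add0r -sumrN; apply: eq_bigr => i _.
rewrite expr1n mul1r /bump/= add1n doubleMl exprM.
rewrite [((r - t) ^+ _) in RHS]exprM -[_ / _ in RHS]mulrA.
rewrite [X in X *- _]exprNn expr_div_n [X in _ * X *- _]expr_div_n -mulr_natr.
by ring.
Qed.

End test.

(** The integral of [h] against [step_poly] with [c = r - x] is evaluated twice. Dominated
    convergence gives the integral of [h] over [[0, x]]; the expansion in powers and the moment
    bounds give at most [C (exp ((rho / c)^(2N)) - 1)], which tends to 0 because [rho < c]. *)
Lemma moment_vanish (r : R) (h : R -> R) (rho C : R) : 0 < rho -> intg 0 r h ->
  (forall n, `|\int[mu]_(t in `[0, r]) ((r - t) ^+ n.*2 * h t)| <= C * rho ^+ n.*2) ->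
  forall x : R, 0 <= x -> x < r - rho -> \int[mu]_(t in `[0, x]) h t = 0.
Proof.
move=> rho0 hi hm x x0 xr; pose c := r - x.
have rc : rho < c by rewrite /c; lra.
have c0 : 0 < c by exact: lt_trans rc.
have r0 : 0 < r by lra.
(* A natural number, since [b^(2N)] has to serve as an exponent, and large enough that
   [(r - t) / (b c)] stays in [[0, 1]]. *)
pose b := (Num.truncn (r / c)).+1.
have b0 : (0 < b)%N by [].
have rbc : r <= b%:R * c.
  by rewrite -ler_pdivrMr// ltW// /b truncnS_gt// divr_ge0 ?ltW.
have lim1 : (fun N => \int[mu]_(t in `[0, r]) (step_poly r c b N t * h t)) @ \oo -->
    \int[mu]_(t in `[0, r]) (h \_ `[0, x]) t.
  apply: (@Rintegral_cvg _ _ _ _ (fun t => `|h t|)) => //.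
  - move=> N; apply: measurable_funM; last exact: intg_measurable hi.
    by apply: measurable_funTS; apply: continuous_measurable_fun; exact: continuous_step_poly.
  - have : mu.-integrable `[0, r] ((EFin \o h) \_ `[0, x]).
      apply/integrable_restrict => //; apply: integrableS hi => //; first exact: measurableI.
    by rewrite restrict_EFin => /measurable_int/measurable_EFinP.
  - exists [set x]; split => //; first exact: lebesgue_measure_set1.
    move=> t /=; apply: contra_notP => /eqP tx; rewrite in_itv/= => t0r.
    rewrite patchE; case: ifPn => [|]; rewrite ?inE ?notin_setE/= in_itv/=.
      case/andP: (t0r) => t0 _; rewrite t0/= => tlx.
      rewrite -[X in _ --> X]mul1r; apply: cvgM; last exact: cvg_cst.
      by apply: step_poly_cvg1 => //; rewrite /c subKr lt_neqAle tx.
    case/andP: (t0r) => t0 _; rewrite t0/= => /negP; rewrite -ltNge => xt.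
    rewrite -[X in _ --> X](mul0r (h t)); apply: cvgM; last exact: cvg_cst.
    by apply: step_poly_cvg0 => //; rewrite /c subKr.
  - exact: integrable_norm.
  - move=> N t /=; rewrite in_itv/= => t0r; rewrite normrM ler_piMl//.
    exact: step_poly_bound.
have lim2 : (fun N => \int[mu]_(t in `[0, r]) (step_poly r c b N t * h t)) @ \oo --> (0 : R).
  apply/norm_cvg0P.
  apply: (@squeeze_cvgr _ _ _ _ (cst 0) (fun N => C * (expR ((rho / c) ^+ N.*2) - 1))).
  - apply: nearW => N; rewrite normr_ge0/=.
    pose M := (b ^ N.*2)%N; pose del := (rho / (b%:R * c)) ^+ N.*2.
    have bc0 : 0 < b%:R * c by rewrite mulr_gt0// ltr0n.
    have del0 : 0 <= del by rewrite exprn_ge0// divr_ge0// ltW.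
    have C0 : 0 <= C by have := hm 0%N; rewrite expr0 mulr1; apply: le_trans.
    pose coef (i : 'I_M) := - (-1) ^+ i.+1 * 'C(M, i.+1)%:R / (b%:R * c) ^+ (N * i.+1).*2.
    have mi k : intg 0 r (fun t => (r - t) ^+ k * h t).
      apply: intgMc hi; apply: continuous_subspaceT.
      by apply: continuousX => t; apply: cvgB; [exact: cvg_cst|exact: cvg_id].
    have -> : \int[mu]_(t in `[0, r]) (step_poly r c b N t * h t) =
        \sum_(i < M) coef i * \int[mu]_(t in `[0, r]) ((r - t) ^+ (N * i.+1).*2 * h t).
      pose F (i : 'I_M) t := coef i * ((r - t) ^+ (N * i.+1).*2 * h t).
      have Fi i : intg 0 r (F i) by exact: intgZ.
      transitivity (\int[mu]_(t in `[0, r]) (\sum_(i < M) F i t)).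
        apply: eq_Rintegral => t _; rewrite step_polyE// mulr_suml.
        by apply: eq_bigr => i _; rewrite /F mulrA.
      have [_ ->] := Rintegral_sum_ord Fi.
      by apply: eq_bigr => i _; rewrite RintegralZl.
    have -> : (rho / c) ^+ N.*2 = M%:R * del.
      rewrite /M /del natrX -exprMn; congr (_ ^+ _); field.
      by rewrite gt_eqF// pnatr_eq0.
    apply: (@le_trans _ _ (C * ((1 + del) ^+ M - 1))); last first.
      by rewrite ler_wpM2l// lerD2r expr_1Dx_le// addr_ge0.
    rewrite exprDn big_ord_recl/= !expr1n mulr1 bin0 mulr1n addrAC subrr add0r.
    rewrite mulr_sumr (le_trans (ler_norm_sum _ _ _))//; apply: ler_sum => i _.
    rewrite normrM (le_trans (ler_wpM2l (normr_ge0 _) (hm _)))//.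
    rewrite /coef !normrM normrN normrX normrN1 expr1n mul1r normfV.
    rewrite ger0_norm ?ler0n// ger0_norm; last by rewrite exprn_ge0// ltW.
    rewrite expr1n mul1r /bump/= add1n -mulr_natr /del -exprM doubleMl expr_div_n.
    by rewrite le_eqVlt; apply/orP; left; apply/eqP; ring.
  - exact: cvg_cst.
  - rewrite -[X in _ --> X](mulr0 C); apply: cvgM; first exact: cvg_cst.
    rewrite -[X in _ --> X](subrr 1) -[X in _ --> X - _]expR0.
    apply: cvgB; last exact: cvg_cst.
    apply: (@cvg_comp _ _ _ (fun N => (rho / c) ^+ N.*2) expR _ (nbhs (0:R))); last exact: continuous_expR.
    by apply: cvg_even; apply/andP; split; [rewrite divr_ge0 ?ltW|rewrite ltr_pdivrMr// mul1r].
have e0 := cvg_unique (@Rhausdorff R) lim1 lim2.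
rewrite -Rintegral_mkcondr in e0; rewrite -[RHS]e0; congr (Rintegral _ _ _).
apply/esym/setIidPr; by apply: subset_itvl; rewrite bnd_simp; lra.
Qed.
(** Lebesgue differentiation: almost everywhere [h] is the derivative of its primitive. The two
    endpoints are discarded because the derivative needs a neighbourhood on which the primitive is
    known to vanish. *)
Lemma ae0_of_Rintegral0 (X : R) (h : R -> R) : intg 0 X h ->
  (forall x : R, 0 <= x < X -> \int[mu]_(t in `[0, x]) h t = 0) ->
  {ae mu, forall x, 0 <= x <= X -> h x = 0}.
Proof.
move=> hi h0; pose g := h \_ `[0, X].
have gi : mu.-integrable setT (EFin \o g).
  by rewrite /g -restrict_EFin; apply/integrable_restrict => //; rewrite setTI.
have := @FTC1 R g (BLeft 0) _ _; move=> /(_ _ _)/wrap[||].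
- by move=> y; apply: integrableS gi.
- by apply: integrable_locally hi.
move=> hF; have h1 : {ae mu, forall x, x != 0 /\ x != X}.
  exists [set 0; X]; split => //.
  - by apply: measurableU; exact: measurable_set1.
  - by rewrite measureU0//; [exact: lebesgue_measure_set1|exact: lebesgue_measure_set1].
  - move=> x /=; apply: contra_notP => /not_orP[/eqP ? /eqP ?] //.
apply: ae_imp (ae_and hF h1) => x [hx [x0 xX]] /andP[x0' xX'].
have xl : 0 < x by rewrite lt_neqAle eq_sym x0.
have xu : x < X by rewrite lt_neqAle xX.
have [|_] := hx; first by rewrite lte_fin.
rewrite /g patchE mem_set/= ?in_itv/= ?x0' ?xX'// => <-.
transitivity (derive1 (cst (0 : R)) x); last by rewrite derive1_cst.
rewrite !derive1E; apply: near_eq_derive.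
have : \forall y \near x, y \in `]0, X[ by apply: near_in_itvoo; rewrite in_itv/= xl.
apply: filterS => y; rewrite in_itv/= => /andP[y0 yX].
rewrite -[RHS](h0 y) ?(ltW y0)//; apply: eq_Rintegral => t; rewrite inE/= in_itv/= => /andP[t0 ty].
by rewrite patchE mem_set//= in_itv/= t0 (le_trans ty)// ltW.
Qed.

(** Both sides integrate [h s * w t] over the triangle [0 <= s <= t <= r]. Extending both functions
    by 0 puts the triangle inside the plane, and [|H s| |W t|] dominates the integrand, so that
    Fubini applies. *)
Lemma triangle_fubini (r : R) (h w : R -> R) : intg 0 r h -> intg 0 r w ->
  \int[mu]_(t in `[0, r]) (w t * \int[mu]_(s in `[0, t]) h s) =
  \int[mu]_(s in `[0, r]) (h s * \int[mu]_(t in `[s, r]) w t).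
Proof.
move=> hi wi; pose H := h \_ `[0, r]; pose W := w \_ `[0, r].
have Hi : mu.-integrable setT (EFin \o H).
  by rewrite /H -restrict_EFin; apply/integrable_restrict => //; rewrite setTI.
have Wi : mu.-integrable setT (EFin \o W).
  by rewrite /W -restrict_EFin; apply/integrable_restrict => //; rewrite setTI.
pose f (z : R * R) : R := if z.1 <= z.2 then H z.1 * W z.2 else 0.
have mf : measurable_fun setT f.
  apply: measurable_fun_ifT => //=.
    by apply: measurable_fun_ler.
  apply: measurable_funM.
    by apply: measurableT_comp => //; move: Hi => /measurable_int/measurable_EFinP.
  by apply: measurableT_comp => //; move: Wi => /measurable_int/measurable_EFinP.
have fi : (mu \x mu)%E.-integrable setT (EFin \o f).
  apply/integrable12ltyP; first exact/measurable_EFinP.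
  have Wn := integrable_fin_num measurableT (integrable_norm Wi).
  pose A := fine (\int[mu]_t (`|W t|)%:E)%E.
  apply: (@le_lt_trans _ _ (\int[mu]_s (A%:E * (`|H s|)%:E))%E); last first.
    apply: integrable_lty => //; apply: integrableZl => //.
    exact: integrable_norm Hi.
  apply: ge0_le_integral => //.
  - by move=> s _; apply: integral_ge0.
  - have := @measurable_fun_fubini_tonelli_F _ _ (measurableTypeR R) (measurableTypeR R) R mu (abse \o (EFin \o f)).
    apply; last by move=> z; exact: abse_ge0.
    by apply: measurableT_comp => //; exact/measurable_EFinP.
  - apply/measurable_EFinP; apply: measurable_funM => //.
    by move: (integrable_norm Hi) => /measurable_int/measurable_EFinP.
  - move=> s _; rewrite /A fineK// muleC -ge0_integralZl//; last first.
      by move: (integrable_norm Wi) => /measurable_int.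
    apply: ge0_le_integral => //.
    + apply: measurableT_comp => //; apply/measurable_EFinP.
      by apply: measurableT_comp => //; exact: measurable_pair1.
    + apply/measurable_EFinP; apply: measurable_funM => //.
      by move: (integrable_norm Wi) => /measurable_int/measurable_EFinP.
    + move=> t _ /=; rewrite lee_fin /f/=; case: ifPn => _; first by rewrite normrM.
      by rewrite normr0 mulr_ge0.
have F1 s : (\int[mu]_t (f (s, t))%:E =
    ((fun s => h s * \int[mu]_(t in `[s, r]) w t) \_ `[0, r] s)%:E)%E.
  rewrite patchE; case: ifPn => [|/negP]; rewrite inE/= in_itv/= => sr; last first.
    have H0 : H s = 0 by rewrite /H patchE memNset//= in_itv.
    by rewrite integral0_eq// => t _; rewrite /f/= H0 mul0r if_same.
  case/andP: (sr) => s0 sr'.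
  have wis : intg s r w by exact: intg_sub wi.
  rewrite -RintegralZl// /Rintegral fineK; last first.
    by apply: integrable_fin_num => //; exact: intgZ.
  rewrite [RHS]integral_mkcond; apply: eq_integral => t _.
  rewrite /f/= patchE /H /W !patchE mem_set/= ?in_itv//=.
  case: ifPn => st; last first.
    by rewrite ifF//; apply/negP; rewrite inE/= in_itv/= (negbTE st).
  have [tr|rt] := leP t r; first by rewrite !mem_set/= ?in_itv/= ?tr ?st// (le_trans s0).
  have tr : (t <= r) = false by rewrite leNgt rt.
  by rewrite !memNset/= ?in_itv/= ?tr ?andbF// mulr0.
have F2 t : (\int[mu]_s (f (s, t))%:E =
    ((fun t => w t * \int[mu]_(s in `[0, t]) h s) \_ `[0, r] t)%:E)%E.
  rewrite patchE; case: ifPn => [|/negP]; rewrite inE/= in_itv/= => tr; last first.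
    have W0 : W t = 0 by rewrite /W patchE memNset//= in_itv.
    by rewrite integral0_eq// => s _; rewrite /f/= W0 mulr0 if_same.
  case/andP: (tr) => t0 tr'.
  have his : intg 0 t h by exact: intg_sub hi.
  rewrite -RintegralZl// /Rintegral fineK; last first.
    by apply: integrable_fin_num => //; exact: intgZ.
  rewrite [RHS]integral_mkcond; apply: eq_integral => s _.
  rewrite /f/= patchE /H /W !patchE (@mem_set _ _ t)/= ?in_itv//=.
  case: ifPn => st; last first.
    by rewrite ifF//; apply/negP; rewrite inE/= in_itv/= (negbTE st) andbF.
  have [s0|s0] := leP 0 s; last first.
    have s0' : (0 <= s) = false by rewrite leNgt s0.
    by rewrite !memNset/= ?in_itv/= ?s0'// mul0r.
  by rewrite !mem_set/= ?in_itv/= ?s0 ?st// 1?mulrC// (le_trans st).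
have := Fubini fi => /=.
under eq_integral do rewrite F1.
under [in RHS]eq_integral do rewrite F2.
by move=> FF; rewrite Rintegral_mkcond [RHS]Rintegral_mkcond /Rintegral FF.
Qed.

End Moments.

(** * Complex and matrix-valued integrals, continuity and square integrability, by components *)

Section ComplexFunctions.
Variable R : realType.
Local Notation C := (R[i]).
Local Notation mu := (@lebesgue_measure R).
Local Notation intg a b f := (mu.-integrable `[a, b] (EFin \o f)).

Lemma creD (x y : C) : cre (x + y) = cre x + cre y. Proof. by case: x; case: y. Qed.
Lemma cimD (x y : C) : cim (x + y) = cim x + cim y. Proof. by case: x; case: y. Qed.
Lemma creN (x : C) : cre (- x) = - cre x. Proof. by case: x. Qed.
Lemma cimN (x : C) : cim (- x) = - cim x. Proof. by case: x. Qed.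
Lemma creM (x y : C) : cre (x * y) = cre x * cre y - cim x * cim y.
Proof. by case: x; case: y. Qed.
Lemma cimM (x y : C) : cim (x * y) = cre x * cim y + cim x * cre y.
Proof. by case: x => a b; case: y => c d; rewrite /cim/=. Qed.
Lemma cre_conj (x : C) : cre (conjc x) = cre x. Proof. by case: x. Qed.
Lemma cim_conj (x : C) : cim (conjc x) = - cim x. Proof. by case: x. Qed.
Lemma cre0 : cre (0 : C) = 0. Proof. by []. Qed.
Lemma cim0 : cim (0 : C) = 0. Proof. by []. Qed.
Lemma cre_sum I (s : seq I) (F : I -> C) :
  cre (\sum_(i <- s) F i) = \sum_(i <- s) cre (F i).
Proof. by elim: s => [|i s IH]; rewrite ?big_nil// !big_cons creD IH. Qed.
Lemma cim_sum I (s : seq I) (F : I -> C) :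
  cim (\sum_(i <- s) F i) = \sum_(i <- s) cim (F i).
Proof. by elim: s => [|i s IH]; rewrite ?big_nil// !big_cons cimD IH. Qed.
Lemma ceqP (x y : C) : cre x = cre y -> cim x = cim y -> x = y.
Proof. by case: x => a b; case: y => c d; rewrite /cre /cim /= => -> ->. Qed.

Definition cintg (a b : R) (g : R -> C) :=
  intg a b (fun x => cre (g x)) /\ intg a b (fun x => cim (g x)).

Definition ccont (a b : R) (g : R -> C) :=
  {within `[a, b], continuous (fun x => cre (g x))} /\
  {within `[a, b], continuous (fun x => cim (g x))}.

Lemma eq_intg (a b : R) (f g : R -> R) : (forall x, a <= x <= b -> f x = g x) ->
  intg a b f -> intg a b g.
Proof.
move=> fg; apply: eq_integrable => // x.
by rewrite inE/= in_itv/= => xab; rewrite /= fg.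
Qed.

Lemma eq_cintg (a b : R) (f g : R -> C) : (forall x, a <= x <= b -> f x = g x) ->
  cintg a b f -> cintg a b g.
Proof. by move=> fg [f1 f2]; split; [apply: eq_intg f1|apply: eq_intg f2] => x /fg ->. Qed.

Lemma eq_cint (a b : R) (f g : R -> C) : (forall x, a <= x <= b -> f x = g x) ->
  cint a b f = cint a b g.
Proof.
by move=> fg; congr Complex; apply: eq_Rintegral => x; rewrite inE/= in_itv/= => /fg ->.
Qed.

Lemma eq_cintmx m n (a b : R) (F G : R -> 'M[C]_(m, n)) :
  (forall x, a <= x <= b -> F x = G x) -> cintmx a b F = cintmx a b G.
Proof. by move=> FG; apply/matrixP => i j; rewrite !mxE; apply: eq_cint => x /FG ->. Qed.

Lemma ae_eq_Rintegral (a b : R) (f g : R -> R) : intg a b f -> intg a b g ->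
  {ae mu, forall x, a <= x <= b -> f x = g x} ->
  \int[mu]_(x in `[a, b]) f x = \int[mu]_(x in `[a, b]) g x.
Proof.
move=> fi gi fg; rewrite /Rintegral; congr fine; apply: ae_eq_integral => //.
- exact: measurable_int fi.
- exact: measurable_int gi.
- by apply: ae_imp fg => x + /= xab; move=> ->//; rewrite in_itv/= in xab.
Qed.

Lemma ae_eq_cint (a b : R) (f g : R -> C) : cintg a b f -> cintg a b g ->
  {ae mu, forall x, a <= x <= b -> f x = g x} -> cint a b f = cint a b g.
Proof.
move=> [f1 f2] [g1 g2] fg; congr Complex; apply: ae_eq_Rintegral => //;
  by apply: ae_imp fg => x h /h ->.
Qed.

Lemma cintg_sub (a b c d : R) g : a <= c -> d <= b -> cintg a b g -> cintg c d g.
Proof. by move=> ac db [h1 h2]; split; apply: intg_sub ac db _. Qed.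

Lemma cintgD a b (f g : R -> C) : cintg a b f -> cintg a b g -> cintg a b (fun x => f x + g x).
Proof.
move=> [f1 f2] [g1 g2]; split.
  by apply: eq_intg (intgD f1 g1) => x _; rewrite creD.
by apply: eq_intg (intgD f2 g2) => x _; rewrite cimD.
Qed.

Lemma cintDe a b (f g : R -> C) : cintg a b f -> cintg a b g ->
  cint a b (fun x => f x + g x) = cint a b f + cint a b g.
Proof.
move=> [f1 f2] [g1 g2]; apply: ceqP; rewrite ?creD ?cimD /cint /cre /cim/=.
  by rewrite -RintegralD//; apply: eq_Rintegral => x _; rewrite -creD.
by rewrite -RintegralD//; apply: eq_Rintegral => x _; rewrite -cimD.
Qed.

Lemma cintgMc a b (f g : R -> C) : ccont a b f -> cintg a b g -> cintg a b (fun x => f x * g x).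
Proof.
move=> [f1 f2] [g1 g2]; split.
  apply: eq_intg (intgB (intgMc f1 g1) (intgMc f2 g2)) => x _.
  by rewrite creM.
apply: eq_intg (intgD (intgMc f1 g2) (intgMc f2 g1)) => x _.
by rewrite cimM.
Qed.

Lemma ccont_cst a b (c : C) : ccont a b (fun _ => c).
Proof. by split; apply: continuous_subspaceT => x; exact: cvg_cst. Qed.

Lemma cintgZ a b c g : cintg a b g -> cintg a b (fun x => c * g x).
Proof. by apply: cintgMc; exact: ccont_cst. Qed.

Lemma cintZ a b c g : cintg a b g -> cint a b (fun x => c * g x) = c * cint a b g.
Proof.
move=> [g1 g2]; apply: ceqP; rewrite ?creM ?cimM.
  rewrite /cint /cre /cim/= -!RintegralZl//.
  rewrite -RintegralB//; [|exact: intgZ|exact: intgZ].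
  by apply: eq_Rintegral => x _; exact: creM.
rewrite /cint /cre /cim/= -!RintegralZl//.
rewrite -RintegralD//; [|exact: intgZ|exact: intgZ].
by apply: eq_Rintegral => x _; exact: cimM.
Qed.

Lemma cintg_sum a b n (F : 'I_n -> R -> C) : (forall i, cintg a b (F i)) ->
  cintg a b (fun x => \sum_(i < n) F i x) /\
  cint a b (fun x => \sum_(i < n) F i x) = \sum_(i < n) cint a b (F i).
Proof.
move=> Fi.
have [r1 r2] := Rintegral_sum_ord (fun i => (Fi i).1).
have [i1 i2] := Rintegral_sum_ord (fun i => (Fi i).2).
split; first split.
- by apply: eq_intg r1 => x _; rewrite cre_sum.
- by apply: eq_intg i1 => x _; rewrite cim_sum.
apply: ceqP; rewrite ?cre_sum ?cim_sum.
  by rewrite /cint [LHS]/cre/= -r2; apply: eq_Rintegral => x _; exact: cre_sum.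
by rewrite /cint [LHS]/cim/= -i2; apply: eq_Rintegral => x _; exact: cim_sum.
Qed.

Lemma cint_conj a b g : cintg a b g -> cint a b (fun x => conjc (g x)) = conjc (cint a b g).
Proof.
move=> [g1 g2]; apply: ceqP; rewrite ?cre_conj ?cim_conj /cint /cre /cim/=.
  by apply: eq_Rintegral => x _; exact: cre_conj.
rewrite -mulN1r -RintegralZl//; apply: eq_Rintegral => x _.
by rewrite mulN1r; exact: cim_conj.
Qed.

Definition mxintg m n a b (G : R -> 'M[C]_(m, n)) := forall i j, cintg a b (fun x => G x i j).
Definition mxcont m n a b (G : R -> 'M[C]_(m, n)) := forall i j, ccont a b (fun x => G x i j).

Lemma cintmx_mull m n q a b (M : 'M[C]_(m, n)) (G : R -> 'M[C]_(n, q)) :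
  mxintg a b G -> M *m cintmx a b G = cintmx a b (fun t => M *m G t).
Proof.
move=> Gi; apply/matrixP => i j; rewrite !mxE.
have := cintg_sum (F := fun k x => M i k * G x k j) (fun k => cintgZ _ (Gi k j)).
move=> [_ e]; rewrite (eq_cint (g := fun x => \sum_k M i k * G x k j)) ?e; last first.
  by move=> x _; rewrite mxE.
by apply: eq_bigr => k _; rewrite mxE cintZ.
Qed.

Lemma cintmx_scale m n a b c (G : R -> 'M[C]_(m, n)) :
  mxintg a b G -> c *: cintmx a b G = cintmx a b (fun t => c *: G t).
Proof.
move=> Gi; apply/matrixP => i j; rewrite !mxE -cintZ//.
by apply: eq_cint => x _; rewrite mxE.
Qed.

Lemma mxintg_mul m n q a b (F : R -> 'M[C]_(m, n)) (G : R -> 'M[C]_(n, q)) :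
  mxcont a b F -> mxintg a b G -> mxintg a b (fun x => F x *m G x).
Proof.
move=> Fc Gi i j.
have [h _] := cintg_sum (fun k => cintgMc (Fc i k) (Gi k j)).
by apply: eq_cintg h => x _; rewrite mxE.
Qed.

Lemma eq_wcont (a b : R) (f g : R -> R) : f =1 g ->
  {within `[a, b], continuous f} -> {within `[a, b], continuous g}.
Proof. by move=> /funext ->. Qed.

Lemma ccontD a b (f g : R -> C) : ccont a b f -> ccont a b g -> ccont a b (fun x => f x + g x).
Proof.
move=> [f1 f2] [g1 g2]; split.
  by apply: eq_wcont (within_continuousD f1 g1) => x; rewrite creD.
by apply: eq_wcont (within_continuousD f2 g2) => x; rewrite cimD.
Qed.

Lemma wcontM a b (f g : R -> R) : {within `[a, b], continuous f} ->
  {within `[a, b], continuous g} -> {within `[a, b], continuous (fun x => f x * g x)}.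
Proof. by move=> cf cg x; apply: cvgM; [exact: cf|exact: cg]. Qed.

Lemma ccontM a b (f g : R -> C) : ccont a b f -> ccont a b g -> ccont a b (fun x => f x * g x).
Proof.
move=> [f1 f2] [g1 g2]; split.
  by apply: eq_wcont (within_continuousB (wcontM f1 g1) (wcontM f2 g2)) => x; rewrite creM.
by apply: eq_wcont (within_continuousD (wcontM f1 g2) (wcontM f2 g1)) => x; rewrite cimM.
Qed.

Lemma ccont_conj a b f : ccont a b f -> ccont a b (fun x => conjc (f x)).
Proof.
move=> [f1 f2]; split.
  by apply: eq_wcont f1 => x; rewrite cre_conj.
have : {within `[a, b], continuous (fun x => (-1 : R) * cim (f x))}.
  by apply: wcontM f2; apply: continuous_subspaceT => x; exact: cvg_cst.
by apply: eq_wcont => x; rewrite cim_conj mulN1r.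
Qed.

Lemma ccont_sum a b n (F : 'I_n -> R -> C) : (forall i, ccont a b (F i)) ->
  ccont a b (fun x => \sum_(i < n) F i x).
Proof.
elim: n F => [|n IH] F Fi.
  have -> : (fun x => \sum_(i < 0) F i x) = fun=> 0.
    by apply/funext => x; rewrite big_ord0.
  exact: ccont_cst.
have -> : (fun x => \sum_(i < n.+1) F i x) =
    fun x => \sum_(i < n) F (widen_ord (leqnSn n) i) x + F ord_max x.
  by apply/funext => x; rewrite big_ord_recr.
by apply: ccontD; [exact: IH|exact: Fi].
Qed.

Lemma ccont_intg a b f : ccont a b f -> cintg a b f.
Proof. by move=> [f1 f2]; split; exact: continuous_intg. Qed.

Lemma ccont_sub a b c d f : a <= c -> d <= b -> ccont a b f -> ccont c d f.
Proof.
move=> ac db [f1 f2]; split; (apply: continuous_subspaceW; [|eassumption]);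
  by apply: subset_itv; rewrite bnd_simp.
Qed.

Lemma ccont_primitive a b g : a <= b -> cintg a b g -> ccont a b (fun x => cint a x g).
Proof. by move=> ab [g1 g2]; split; exact: parameterized_integral_continuous. Qed.

Lemma mxcont_mul m n q a b (F : R -> 'M[C]_(m, n)) (G : R -> 'M[C]_(n, q)) :
  mxcont a b F -> mxcont a b G -> mxcont a b (fun x => F x *m G x).
Proof.
move=> Fc Gi i j.
have -> : (fun x => (F x *m G x) i j) = (fun x => \sum_k F x i k * G x k j).
  by apply/funext => x; rewrite mxE.
by apply: ccont_sum => k; apply: ccontM.
Qed.

Lemma mxcont_cst m n a b (M : 'M[C]_(m, n)) : mxcont a b (fun _ => M).
Proof. by move=> i j; exact: ccont_cst. Qed.

Lemma mxcont_adj m n a b (G : R -> 'M[C]_(m, n)) : mxcont a b G ->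
  mxcont a b (fun x => mxadj (G x)).
Proof.
move=> Gc i j; have -> : (fun x => mxadj (G x) i j) = (fun x => conjc (G x j i)).
  by apply/funext => x; rewrite !mxE.
exact: ccont_conj.
Qed.

Lemma mxcont_scale m n a b c (G : R -> 'M[C]_(m, n)) : mxcont a b G ->
  mxcont a b (fun x => c *: G x).
Proof.
move=> Gc i j; have -> : (fun x => (c *: G x) i j) = (fun x => c * G x i j).
  by apply/funext => x; rewrite !mxE.
by apply: ccontM => //; exact: ccont_cst.
Qed.

Lemma mxcont_primitive m n a b (G : R -> 'M[C]_(m, n)) : a <= b -> mxintg a b G ->
  mxcont a b (fun x => cintmx a x G).
Proof.
move=> ab Gi i j; have -> : (fun x => cintmx a x G i j) = (fun x => cint a x (fun t => G t i j)).
  by apply/funext => x; rewrite !mxE.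
exact: ccont_primitive.
Qed.

Lemma cabs2_ge0 (z : C) : 0 <= cabs2 z.
Proof. by rewrite addr_ge0// sqr_ge0. Qed.

Lemma intg_le (a b : R) (f g : R -> R) : measurable_fun `[a, b] f ->
  (forall x, a <= x <= b -> `|f x| <= g x) -> intg a b g -> intg a b f.
Proof.
move=> mf fg; apply: le_integrable => //; first exact/measurable_EFinP.
move=> x /=; rewrite in_itv/= => /fg h; rewrite lee_fin.
by rewrite (le_trans h)// ler_norm.
Qed.

Lemma ccont_L2 l g : ccont 0 l g -> L2c l g.
Proof.
move=> [c1 c2]; split; first exact: intg_measurable (continuous_intg c1).
split; first exact: intg_measurable (continuous_intg c2).
apply: (@continuous_intg R 0 l (fun x => cabs2 (g x))).
exact: (within_continuousD (wcontM c1 c1) (wcontM c2 c2)).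
Qed.

(** Up to a sign, both parts of a complex product have the form [a c - b d]; this bound makes a
    product of two square-integrable functions integrable. *)
Lemma norm_cross_le (a b c d : R) :
  `|a * c - b * d| <= (a ^+ 2 + b ^+ 2) + (c ^+ 2 + d ^+ 2).
Proof.
have := sqr_ge0 (a - c); have := sqr_ge0 (a + c).
have := sqr_ge0 (b - d); have := sqr_ge0 (b + d).
have := sqr_ge0 a; have := sqr_ge0 b; have := sqr_ge0 c; have := sqr_ge0 d.
by rewrite ler_norml => *; apply/andP; split; lra.
Qed.

Lemma L2c_mul l (f g : R -> C) : L2c l f -> L2c l g -> cintg 0 l (fun x => f x * g x).
Proof.
move=> [f1 [f2 f3]] [g1 [g2 g3]].
have s : intg 0 l (fun x => cabs2 (f x) + cabs2 (g x)) by exact: intgD.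
split; apply: intg_le s.
- rewrite (_ : (fun x => cre (f x * g x)) = fun x => cre (f x) * cre (g x) - cim (f x) * cim (g x)); last by apply/funext => x; rewrite creM.
  by apply: measurable_funB; apply: measurable_funM.
- by move=> x _; rewrite creM; exact: norm_cross_le.
- rewrite (_ : (fun x => cim (f x * g x)) = fun x => cre (f x) * cim (g x) + cim (f x) * cre (g x)); last by apply/funext => x; rewrite cimM.
  by apply: measurable_funD; apply: measurable_funM.
- move=> x _; rewrite cimM -[cre (f x) * _]opprK opprK -[cim (f x) * _]opprK -mulrN.
  by rewrite (le_trans (norm_cross_le _ _ _ _))// sqrrN /cabs2; lra.
Qed.

Lemma L2c_cst l (c : C) : L2c l (fun _ => c).
Proof. by apply: ccont_L2; exact: ccont_cst. Qed.

Lemma L2c_intg l f : L2c l f -> cintg 0 l f.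
Proof.
by move=> fl; apply: eq_cintg (L2c_mul (L2c_cst l 1) fl) => x _; rewrite mul1r.
Qed.

Lemma L2c_conj l (f : R -> C) : L2c l f -> L2c l (fun x => conjc (f x)).
Proof.
move=> [f1 [f2 f3]]; split.
  by rewrite (_ : (fun x => cre (f x)^*%C) = fun x => cre (f x)) //; apply/funext => x; rewrite cre_conj.
split.
  rewrite (_ : (fun x => cim (f x)^*%C) = fun x => - cim (f x)); last by apply/funext => x; rewrite cim_conj.
  exact: measurableT_comp.
by apply: eq_intg f3 => x _; rewrite /cabs2 cre_conj cim_conj sqrrN.
Qed.

Lemma L2c_sub l r (f : R -> C) : l <= r -> L2c r f -> L2c l f.
Proof.
move=> lr [f1 [f2 f3]].
have s : `[0, l] `<=` `[0, r] by apply: subset_itvl; rewrite bnd_simp.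
split; first exact: measurable_funS f1.
split; first exact: measurable_funS f2.
exact: (@intg_sub R 0 r 0 l (fun x => cabs2 (f x))).
Qed.

Lemma L2c_ext l r (f : R -> C) : l <= r -> L2c l f ->
  L2c r (fun x => if 0 <= x <= l then f x else 0).
Proof.
move=> lr [f1 [f2 f3]].
have e (F : C -> R) : F 0 = 0 -> (fun x => F (if 0 <= x <= l then f x else 0)) =
    (fun x => F (f x)) \_ `[0, l].
  move=> F0; apply/funext => x; rewrite patchE; case: ifPn => h.
    by rewrite mem_set//= in_itv.
  by rewrite memNset/= ?in_itv//= ?F0//; apply/negP.
have si : `[0, r] `&` `[0, l] = `[0, l]%classic :> set R.
  by apply/setIidPr; apply: subset_itvl; rewrite bnd_simp.
split; first by rewrite (e (@cre R))//; apply/measurable_restrict => //; rewrite si.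
split; first by rewrite (e (@cim R))//; apply/measurable_restrict => //; rewrite si.
have e0 : @cabs2 R 0 = 0 by rewrite /cabs2 /cre /cim/= expr0n addr0.
change (intg 0 r (fun x => cabs2 (if 0 <= x <= l then f x else 0))).
rewrite (e (@cabs2 R) e0) -restrict_EFin; apply/integrable_restrict => //; rewrite si.
exact: f3.
Qed.

End ComplexFunctions.

(** * Taylor expansion with one-sided derivatives and the kernel of [K] near the diagonal *)

Section Kernel.
Variable R : realType.
Local Notation C := (R[i]).
Local Notation mu := (@lebesgue_measure R).
Local Notation intg a b f := (mu.-integrable `[a, b] (EFin \o f)).

Definition wderiv (r : R) (f : R -> R) (x d : R) :=
  (fun y => (y - x)^-1 * (f y - f x)) @ within [set y | 0 <= y <= r] x^' --> d.

Lemma wderiv_approx r f x d : wderiv r f x d -> forall e, 0 < e ->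
  exists2 del, 0 < del & forall y, 0 <= y <= r -> `|y - x| < del ->
    `|f y - f x - d * (y - x)| <= e * `|y - x|.
Proof.
move=> /cvgrPdist_le h e /h; rewrite near_withinE.
move=> /nbhs_ballP[del /= del0 H]; exists del => // y yr yx.
have [->|yneq] := eqVneq y x; first by rewrite !subrr mulr0 subrr normr0 mulr0.
have : ball x del y by rewrite /ball/= distrC.
move=> /H/(_ yneq yr).
have yx0 : y - x != 0 by rewrite subr_eq0.
rewrite distrC => {}H.
have -> : f y - f x - d * (y - x) = ((y - x)^-1 * (f y - f x) - d) * (y - x).
  by field.
by rewrite normrM ler_wpM2r.
Qed.

Lemma wderiv_continuous r f df : (forall x, 0 <= x <= r -> wderiv r f x (df x)) ->
  {within `[0, r], continuous f}.
Proof.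
move=> fd; apply/subspace_continuousP => x /=; rewrite in_itv/= => xr.
have [del del0 H] := wderiv_approx (fd x xr) ltr01.
apply/cvgrPdist_le => e e0; rewrite near_withinE.
pose K := `|df x| + 1; have K0 : 0 < K by rewrite ltr_wpDl.
apply/nbhs_ballP; exists (Num.min del (e / K)) => /=.
  by rewrite lt_min del0 divr_gt0.
move=> y; rewrite /ball/= lt_min distrC => /andP[y1 y2]; rewrite in_itv/= => yr.
rewrite distrC; have := H y yr y1; rewrite mul1r => h.
have -> : f y - f x = (f y - f x - df x * (y - x)) + df x * (y - x) by ring.
rewrite (le_trans (ler_normD _ _))// normrM.
apply: (@le_trans _ _ (K * `|y - x|)); first by rewrite /K; lra.
by rewrite mulrC -ler_pdivlMr// ltW.
Qed.

Lemma wderiv_is_derive r (f : R -> R) x d : 0 < x < r -> wderiv r f x d -> is_derive x 1 f d.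
Proof.
move=> /andP[x0 xr] fd.
have c : (h^-1 *: (f (h *: 1 + x) - f x)) @[h --> (0 : R)^'] --> d.
  apply/cvgrPdist_le => e e0; have [del del0 H] := wderiv_approx fd e0.
  rewrite /dnbhs near_withinE.
  apply/nbhs_ballP; exists (Num.min del (Num.min x (r - x))) => /=.
    by rewrite !lt_min del0 x0 subr_gt0.
  move=> h; rewrite /ball/= sub0r normrN !lt_min => /and3P[h1 h2 h3] h0.
  have /ltr_normlP[h2a h2b] := h2; have /ltr_normlP[h3a h3b] := h3.
  have := H (h + x); rewrite addrK => /(_ _ h1)/wrap[].
    by apply/andP; split; lra.
  rewrite distrC [h *: 1]mulr1 => {}H.
  have -> : d - h^-1 *: (f (h + x) - f x) = h^-1 * (d * h - (f (h + x) - f x)).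
    by rewrite /GRing.scale/=; field.
  by rewrite normrM normfV mulrC ler_pdivrMr// normr_gt0.
split; first by apply/cvg_ex; exists d.
exact/cvg_lim.
Qed.

Lemma Rintegral_sq_sub (a b c d : R) (g : R -> R) : a <= c -> d <= b ->
  intg a b (fun x => g x ^+ 2) ->
  \int[mu]_(x in `[c, d]) (g x ^+ 2) <= \int[mu]_(x in `[a, b]) (g x ^+ 2).
Proof.
move=> ac db gi; have gi' := intg_sub ac db gi.
rewrite /Rintegral fine_le//; [exact: integrable_fin_num|exact: integrable_fin_num|].
apply: ge0_subset_integral => //.
- exact: measurable_int gi.
- by move=> x _; rewrite lee_fin sqr_ge0.
- by apply: subset_itv; rewrite bnd_simp.
Qed.

Lemma intg_cst (a b c : R) : intg a b (fun _ => c).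
Proof. by apply: continuous_intg; apply: continuous_subspaceT => x; exact: cvg_cst. Qed.

Lemma Rintegral_itv_cst (a b c : R) : a <= b -> \int[mu]_(x in `[a, b]) c = c * (b - a).
Proof.
move=> ab; rewrite Rintegral_cst//; congr (_ * _).
have e : mu `[a, b] = if (a%:E < b%:E)%E then (b%:E - a%:E)%E else 0%E.
  exact: (lebesgue_measure_itv `[a, b]).
transitivity (fine (mu `[a, b])) => //; rewrite e lte_fin; case: ltgtP ab => //= -> _.
by rewrite subrr.
Qed.

(* AM-GM with a free parameter [eta] takes the place of Cauchy-Schwarz in [primitive_dist];
   in [weighted_bound] below the parameter is [1 / B]. *)
Lemma norm_le_sq (g eta : R) : 0 < eta -> `|g| <= eta * g ^+ 2 + 1 / (4 * eta).
Proof.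
move=> e0; rewrite -(real_normK (num_real g)); set a := `|g|.
have : 0 <= (2 * eta * a - 1) ^+ 2 / (4 * eta) by rewrite divr_ge0 ?sqr_ge0// mulr_ge0// ltW.
rewrite (_ : (2 * eta * a - 1) ^+ 2 / (4 * eta) = eta * a ^+ 2 + 1 / (4 * eta) - a); first lra.
by field; rewrite gt_eqF.
Qed.

Lemma primitive_dist (r : R) (g : R -> R) (eta t xi : R) : 0 < eta -> 0 <= t -> t <= xi -> xi <= r ->
  intg 0 r g -> intg 0 r (fun x => g x ^+ 2) ->
  `|\int[mu]_(s in `[0, xi]) g s - \int[mu]_(s in `[0, t]) g s| <=
  eta * \int[mu]_(s in `[0, r]) (g s ^+ 2) + (xi - t) / (4 * eta).
Proof.
move=> e0 t0 txi xir gi g2i.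
have gi1 : intg 0 xi g by exact: intg_sub gi.
have gi2 : intg t xi g by exact: intg_sub gi.
have g2i2 : intg t xi (fun x => g x ^+ 2) by exact: intg_sub g2i.
rewrite (@Rintegral_itvB R g (BLeft 0) (BRight xi) t)// ?bnd_simp//.
rewrite Rintegral_itv_obnd_cbnd; last first.
  by apply: integrableS gi2 => //; apply: subset_itvr; rewrite bnd_simp.
apply: (@le_trans _ _ (\int[mu]_(s in `[t, xi]) (eta * g s ^+ 2 + 1 / (4 * eta)))).
  apply: Rintegral_bound => //.
    by apply: intgD; [exact: intgZ|exact: intg_cst].
  by move=> x _; exact: norm_le_sq.
rewrite RintegralD//; [|exact: intgZ|exact: intg_cst].
rewrite Rintegral_itv_cst// RintegralZl//.
rewrite lerD//; first by rewrite ler_pM2l//; exact: Rintegral_sq_sub.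
by rewrite mulrC mulrA mulr1.
Qed.

(** The mean value theorem turns the remainder into [(x - t) (f1 xi - f1 t)], and the increment of
    [f1] is an integral of [g]. Since [eta] is free, this is a quantitative form of [o(x - t)],
    uniform in [t]. *)
Lemma taylor_bound (r : R) (f f1 g : R -> R) (c0 eta t x : R) : 0 < eta ->
  (forall x, 0 <= x <= r -> wderiv r f x (f1 x)) ->
  (forall x, 0 <= x <= r -> f1 x = c0 + \int[mu]_(s in `[0, x]) g s) ->
  intg 0 r g -> intg 0 r (fun x => g x ^+ 2) -> 0 <= t -> t <= x -> x <= r ->
  `|f x - f t - (x - t) * f1 t| <=
  (x - t) * (eta * \int[mu]_(s in `[0, r]) (g s ^+ 2) + (x - t) / (4 * eta)).
Proof.
move=> e0 fd f1E gi g2i t0; rewrite le_eqVlt => /predU1P[<-|tx] xr.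
  by rewrite !subrr !mul0r subrr normr0.
have [||xi] := @MVT R f f1 t x tx.
- move=> y; rewrite in_itv/= => /andP[ty yx]; apply: (@wderiv_is_derive r).
    by rewrite (le_lt_trans t0 ty) (lt_le_trans yx).
  by apply: fd; apply/andP; split; lra.
- apply: continuous_subspaceW (wderiv_continuous fd).
  by apply: subset_itv; rewrite bnd_simp.
rewrite in_itv/= => /andP[txi xix] ->.
rewrite -[(x - t) * f1 t]mulrC -mulrBl normrM mulrC.
have xt : 0 < x - t by rewrite subr_gt0.
rewrite (gtr0_norm xt) ler_pM2l//.
rewrite !f1E; [|by apply/andP; split; lra|by apply/andP; split; lra].
rewrite opprD addrACA subrr add0r.
have := primitive_dist e0 t0 (ltW txi) (le_trans (ltW xix) xr) gi g2i.
move=> /le_trans; apply; rewrite lerD2l ler_pM2r ?invr_gt0 ?mulr_gt0//; lra.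
Qed.

(** Separate bounds on the two parts reduce complex integrals to real ones. The factor 2 lost in
    [cbndM] only reaches quantities whose constant is free; multiplication by a real number,
    [cbnd_real], loses nothing. *)
Definition cbnd (z : C) (M : R) := `|cre z| <= M /\ `|cim z| <= M.

Lemma cbnd_le z M N : M <= N -> cbnd z M -> cbnd z N.
Proof. by move=> MN [h1 h2]; split; exact: le_trans MN. Qed.

Lemma cbndD z w M N : cbnd z M -> cbnd w N -> cbnd (z + w) (M + N).
Proof.
by move=> [h1 h2] [h3 h4]; split; rewrite ?creD ?cimD (le_trans (ler_normD _ _))// lerD.
Qed.

Lemma cbndM z w M N : cbnd z M -> cbnd w N -> cbnd (z * w) (2 * (M * N)).
Proof.
move=> [h1 h2] [h3 h4]; rewrite mulr_natl mulr2n; split; rewrite ?creM ?cimM.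
  by rewrite (le_trans (ler_normB _ _))// !normrM lerD// ler_pM.
by rewrite (le_trans (ler_normD _ _))// !normrM lerD// ler_pM.
Qed.

Lemma cbndi z M : cbnd z M -> cbnd (iC R * z) M.
Proof.
move=> [h1 h2]; split; rewrite ?creM ?cimM /iC [cre (_ +i* _)%C]/= [cim (_ +i* _)%C]/=.
  by rewrite /cre/= mul0r sub0r mul1r normrN.
by rewrite /cim/= mul0r add0r mul1r.
Qed.

Lemma cbnd_sum n (F : 'I_n -> C) M : (forall i, cbnd (F i) M) ->
  cbnd (\sum_i F i) (n%:R * M).
Proof.
move=> FM; split; rewrite ?cre_sum ?cim_sum (le_trans (ler_norm_sum _ _ _))//;
  rewrite mulr_natl -[in leRHS](card_ord n) -sumr_const; apply: ler_sum => i _;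
  by case: (FM i).
Qed.

Lemma mxcont_bound m n a b (G : R -> 'M[C]_(m, n)) : mxcont a b G ->
  exists2 B, 0 <= B & forall x, a <= x <= b -> forall i j, cbnd (G x i j) B.
Proof.
move=> Gc; have /choice[F HF] : forall ij : 'I_m * 'I_n,
    exists B, 0 <= B /\ forall x, a <= x <= b -> cbnd (G x ij.1 ij.2) B.
  move=> [i j]; have [c1 c2] := Gc i j.
  have [B1 B10 h1] := continuous_bound c1; have [B2 B20 h2] := continuous_bound c2.
  exists (B1 + B2); split; first by rewrite addr_ge0.
  move=> x xab; split; first by rewrite (le_trans (h1 x xab))// lerDl.
  by rewrite (le_trans (h2 x xab))// lerDr.
exists (\sum_ij F ij); first by apply: sumr_ge0 => ij _; case: (HF ij).
move=> x xab i j; have [_ /(_ x xab)] := HF (i, j); apply: cbnd_le.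
rewrite (bigD1 (i, j))//= lerDl; apply: sumr_ge0 => ij _; by case: (HF ij).
Qed.

Lemma deriv_on_re m n r (G G1 : R -> 'M[C]_(m, n)) i j : deriv_on r G G1 ->
  forall x, 0 <= x <= r -> wderiv r (fun y => cre (G y i j)) x (cre (G1 x i j)).
Proof. by move=> Gd x /Gd /(_ i j)[]. Qed.

Lemma deriv_on_im m n r (G G1 : R -> 'M[C]_(m, n)) i j : deriv_on r G G1 ->
  forall x, 0 <= x <= r -> wderiv r (fun y => cim (G y i j)) x (cim (G1 x i j)).
Proof. by move=> Gd x /Gd /(_ i j)[]. Qed.

Lemma deriv_on_cont m n r (G G1 : R -> 'M[C]_(m, n)) : deriv_on r G G1 -> mxcont 0 r G.
Proof.
move=> Gd i j; split.
  exact: wderiv_continuous (deriv_on_re (i := i) (j := j) Gd).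
exact: wderiv_continuous (deriv_on_im (i := i) (j := j) Gd).
Qed.

Lemma L2c_sq l (g : R -> C) : L2c l g ->
  intg 0 l (fun x => cre (g x) ^+ 2) /\ intg 0 l (fun x => cim (g x) ^+ 2).
Proof.
move=> [g1 [g2 g3]]; split; apply: intg_le g3.
- exact: measurable_funX.
- by move=> x _; rewrite ger0_norm ?sqr_ge0// /cabs2 lerDl sqr_ge0.
- exact: measurable_funX.
- by move=> x _; rewrite ger0_norm ?sqr_ge0// /cabs2 lerDr sqr_ge0.
Qed.

(** [N] is the sum of the squared norms of all entries of the second derivative, so one constant
    serves every entry and every [eta]. *)
Lemma classU_taylor m n r (G G1 : R -> 'M[C]_(m, n)) : classU r G G1 ->
  exists2 N, 0 <= N & forall eta t x, 0 < eta -> 0 <= t -> t <= x -> x <= r ->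
    forall i j, cbnd ((G x - G t - (x - t)%:C%C *: G1 t) i j)
      ((x - t) * (N * eta + (x - t) / eta)).
Proof.
move=> [Gd [G2 [G2L G1E]]].
pose F (ij : 'I_m * 'I_n) := \int[mu]_(s in `[0, r]) (cre (G2 s ij.1 ij.2) ^+ 2) +
  \int[mu]_(s in `[0, r]) (cim (G2 s ij.1 ij.2) ^+ 2).
have F0 ij : 0 <= F ij by rewrite addr_ge0// Rintegral_ge0// => x _; rewrite sqr_ge0.
exists (\sum_ij F ij); first exact: sumr_ge0.
move=> eta t x e0 t0 tx xr i j; rewrite !mxE.
have [i1 i2] := L2c_intg (G2L i j); have [s1 s2] := L2c_sq (G2L i j).
have FN : F (i, j) <= \sum_ij F ij by rewrite (bigD1 (i, j))//= lerDl sumr_ge0.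
have r1 := taylor_bound (c0 := cre (G1 0 i j)) e0 (deriv_on_re (i := i) (j := j) Gd) _ i1 s1 t0 tx xr.
have r2 := taylor_bound (c0 := cim (G1 0 i j)) e0 (deriv_on_im (i := i) (j := j) Gd) _ i2 s2 t0 tx xr.
have fin I : I <= F (i, j) -> (x - t) * (eta * I + (x - t) / (4 * eta)) <=
    (x - t) * ((\sum_ij F ij) * eta + (x - t) / eta).
  move=> IF; rewrite ler_wpM2l ?subr_ge0// lerD//.
    by rewrite mulrC ler_wpM2r// ?(ltW e0)// (le_trans IF).
  rewrite ler_wpM2l ?subr_ge0// lef_pV2 ?posrE ?mulr_gt0//; lra.
split.
- have -> : cre (G x i j - G t i j - (x - t)%:C%C * G1 t i j) =
    cre (G x i j) - cre (G t i j) - (x - t) * cre (G1 t i j).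
    by rewrite !creD !creN creM/= mul0r subr0.
  apply: le_trans (r1 _) (fin _ _).
    by move=> y yr; rewrite (G1E y yr) !mxE creD.
  by rewrite /F lerDl Rintegral_ge0// => s _; rewrite sqr_ge0.
- have -> : cim (G x i j - G t i j - (x - t)%:C%C * G1 t i j) =
    cim (G x i j) - cim (G t i j) - (x - t) * cim (G1 t i j).
    by rewrite !cimD !cimN cimM/= mul0r addr0.
  apply: le_trans (r2 _) (fin _ _).
    by move=> y yr; rewrite (G1E y yr) !mxE cimD.
  by rewrite /F lerDr Rintegral_ge0// => s _; rewrite sqr_ge0.
Qed.

Definition Kker p (b : R -> 'M[C]_(p, p + p)) (x t : R) : 'M[C]_p :=
  iC R *: (b x *m Jmx R p *m mxadj (b t)).

Lemma iC2 : iC R * iC R = -1 :> C.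
Proof. by apply: ceqP; rewrite ?creM ?cimM ?creN ?cimN /iC /cre /cim/=; ring. Qed.

(** Expand [b x] at [t] in [i b(x) J] times the adjoint of [b t]: the zeroth-order term vanishes by
    the first identity, and the first-order term is [i (x - t) i = -(x - t)] by the second. Only the
    Taylor remainder of [b] is left. *)
Lemma Kker_bound p r (b b1 : R -> 'M[C]_(p, p + p)) : classU r b b1 ->
  (forall x, 0 <= x <= r -> b x *m Jmx R p *m mxadj (b x) = 0) ->
  (forall x, 0 <= x <= r -> b1 x *m Jmx R p *m mxadj (b x) = iC R *: 1%:M) ->
  exists2 N, 0 <= N & forall eta t x, 0 < eta -> 0 <= t -> t <= x -> x <= r ->
    forall i j, cbnd ((Kker b x t + (x - t)%:C%C *: 1%:M) i j)
      ((x - t) * (N * (eta + (x - t) / eta))).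
Proof.
move=> bU b0 b1i; have [N N0 HN] := classU_taylor bU.
have bc := deriv_on_cont bU.1.
have [B B0 HB] := mxcont_bound (mxcont_mul (mxcont_cst 0 r (Jmx R p)) (mxcont_adj bc)).
(* [p + p] counts the terms of the matrix product, 2 comes from [cbndM], [B] bounds [J] times the
   adjoint of [b], and [N + 1] dominates both coefficients of [N eta + (x - t) / eta]. *)
exists ((p + p)%:R * (2 * ((N + 1) * B))) => [|eta t x e0 t0 tx xr i j].
  by rewrite !mulr_ge0// addr_ge0.
have tr : 0 <= t <= r by rewrite t0 (le_trans tx).
have -> : Kker b x t + (x - t)%:C%C *: 1%:M =
    iC R *: ((b x - b t - (x - t)%:C%C *: b1 t) *m (Jmx R p *m mxadj (b t))).
  rewrite !mulmxA !mulmxBl -!scalemxAl b0// b1i// subr0 scalerBr /Kker.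
  by rewrite scalerA scalerA -mulrA mulrC -mulrA iC2 mulrN1 scaleNr opprK.
rewrite mxE; apply: cbndi; rewrite mxE.
apply: (@cbnd_le _ ((p + p)%:R * (2 * (((x - t) * (N * eta + (x - t) / eta)) * B)))); last first.
  by apply: cbnd_sum => k; apply: cbndM; [exact: HN|exact: HB].
have xt : 0 <= x - t by rewrite subr_ge0.
have xte : 0 <= (x - t) / eta by rewrite divr_ge0// ltW.
rewrite [X in _ <= X](_ : _ = (p + p)%:R * (2 * (((x - t) * ((N + 1) * (eta + (x - t) / eta))) * B))); last by ring.
rewrite !ler_wpM2l// ler_wpM2r// ler_wpM2l//.
have : 0 <= N * ((x - t) / eta) by rewrite mulr_ge0.
set q := (x - t) / eta in xte *; move=> h.
rewrite [X in _ <= X](_ : _ = N * eta + q + (N * q + eta)); last by ring.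
by rewrite lerDl addr_ge0// ltW.
Qed.

End Kernel.

(** * Divided powers, and the moments of the iterates of [A] *)

Section Volterra.
Variable R : realType.
Local Notation C := (R[i]).
Local Notation mu := (@lebesgue_measure R).
Local Notation intg a b f := (mu.-integrable `[a, b] (EFin \o f)).

Lemma is_deriveD_fun (f g : R -> R) (t df dg : R) : is_derive t 1 f df -> is_derive t 1 g dg ->
  is_derive t 1 (fun s => f s + g s) (df + dg).
Proof. by move=> hf hg; exact: is_deriveD. Qed.

Lemma is_deriveM_fun (f g : R -> R) (t df dg : R) : is_derive t 1 f df -> is_derive t 1 g dg ->
  is_derive t 1 (fun s => f s * g s) (f t * dg + g t * df).
Proof. by move=> hf hg; exact: is_deriveM. Qed.

Lemma is_derive_cst_fun (c t : R) : is_derive t 1 (fun _ : R => c) 0.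
Proof. exact: is_derive_cst. Qed.

(** Divided powers: differentiation and integration shift the index without a numerical factor, so
    iterated integrals keep a closed form. *)
Definition dpow (k : nat) (u : R) : R := u ^+ k / k`!%:R.

Lemma dpow0 u : dpow 0 u = 1. Proof. by rewrite /dpow expr0 fact0 divr1. Qed.
Lemma dpowS0 k : dpow k.+1 0 = 0. Proof. by rewrite /dpow expr0n mul0r. Qed.
Lemma dpow_ge0 k u : 0 <= u -> 0 <= dpow k u.
Proof. by move=> u0; rewrite divr_ge0// exprn_ge0. Qed.
Lemma dpow1 u : dpow 1 u = u. Proof. by rewrite /dpow expr1 factS fact0 muln1 divr1. Qed.
Lemma dpowS k u : dpow k.+1 u = dpow k u * (u / k.+1%:R).
Proof.
rewrite /dpow exprS factS natrM; field.
by rewrite pnatr_eq0 -lt0n fact_gt0/= nat1r pnatr_eq0.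
Qed.

Lemma is_derive_dpow (f : R -> R) (t df : R) k : is_derive t 1 f df ->
  is_derive t 1 (fun s => dpow k.+1 (f s)) (dpow k (f t) * df).
Proof.
move=> fd; have h := is_deriveX k.+1 fd.
have h2 := is_deriveM_fun h (is_derive_cst_fun (k.+1)`!%:R^-1 t).
have e n s : (f ^+ n) s = f s ^+ n by elim: n => // n IH; rewrite !exprS -IH.
have -> : (fun s => dpow k.+1 (f s)) = (fun s => (f ^+ k.+1) s / (k.+1)`!%:R).
  by apply/funext => s; rewrite e.
apply: is_derive_eq h2 _; rewrite mulr0 add0r /dpow/= factS natrM /GRing.scale/=; field.
by rewrite pnatr_eq0 -lt0n fact_gt0/= nat1r pnatr_eq0.
Qed.

Lemma continuous_dpow k (f : R -> R) : continuous f -> continuous (fun s => dpow k (f s)).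
Proof.
by move=> cf t; apply: cvgM; [exact: (continuousX (n := k) cf)|exact: cvg_cst].
Qed.

Lemma continuous_linB (c : R) : continuous (fun t : R => t - c).
Proof. by move=> t; apply: cvgB; [exact: cvg_id|exact: cvg_cst]. Qed.

Lemma continuous_Blin (c : R) : continuous (fun t : R => c - t).
Proof. by move=> t; apply: cvgB; [exact: cvg_cst|exact: cvg_id]. Qed.

Lemma is_derive_linB (c t : R) : is_derive t 1 (fun s : R => s - c) 1.
Proof.
have := is_deriveD_fun (is_derive_id t 1) (is_derive_cst_fun (- c) t).
by rewrite addr0.
Qed.

Lemma is_derive_Blin (c t : R) : is_derive t 1 (fun s : R => c - s) (-1).
Proof.
have := is_deriveD_fun (is_derive_cst_fun c t) (is_deriveNid t 1).
by rewrite add0r.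
Qed.

Lemma Rintegral_FTC (F f : R -> R) (a b : R) : a <= b -> continuous f ->
  (forall t : R, is_derive t 1 F (f t)) -> \int[mu]_(t in `[a, b]) f t = F b - F a.
Proof.
rewrite le_eqVlt => /predU1P[<- _ _|ab cf Fd].
  by rewrite set_itv1 Rintegral_set1 subrr.
have cF : continuous F.
  move=> t; have [Fdt _] := Fd t.
  exact/differentiable_continuous/derivable1_diffP.
rewrite /Rintegral (@continuous_FTC2 R f F)//.
- exact: continuous_subspaceT.
- split; first by move=> t _; case: (Fd t).
  + by apply: cvg_at_right_filter; exact: cF.
  + by apply: cvg_at_left_filter; exact: cF.
- by move=> t _; rewrite derive1E; case: (Fd t).
Qed.

Lemma Rintegral_dpow (l x A B : R) (k : nat) : l <= x ->
  \int[mu]_(t in `[l, x]) ((A * (x - t) + B * (x - t) ^+ 2) * dpow k (t - l)) =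
  A * dpow k.+2 (x - l) + 2 * B * dpow k.+3 (x - l).
Proof.
move=> lx.
(* An antiderivative found by integrating by parts until the factor [x - t] is used up; every term
   of it vanishes at [t = l]. *)
pose F t := A * ((x - t) * dpow k.+1 (t - l) + dpow k.+2 (t - l)) +
  B * ((x - t) * (x - t) * dpow k.+1 (t - l) +
    (2 * ((x - t) * dpow k.+2 (t - l)) + 2 * dpow k.+3 (t - l))).
have cf : continuous (fun t => (A * (x - t) + B * (x - t) ^+ 2) * dpow k (t - l)).
  move=> t; apply: cvgM; last first.
    exact: (continuous_dpow (k := k) (continuous_linB (c := l))).
  apply: cvgD; apply: cvgM; [exact: cvg_cst|exact: continuous_Blin|exact: cvg_cst|].
  exact: (continuousX (n := 2) (continuous_Blin (c := x))).
have Fd (t : R) : is_derive t 1 F ((A * (x - t) + B * (x - t) ^+ 2) * dpow k (t - l)).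
  have d1 := is_derive_Blin x t.
  have d2 j := is_derive_dpow j (is_derive_linB l t).
  have c j := is_derive_cst_fun j t.
  have h := is_deriveD_fun
    (is_deriveM_fun (c A) (is_deriveD_fun (is_deriveM_fun d1 (d2 k)) (d2 k.+1)))
    (is_deriveM_fun (c B) (is_deriveD_fun (is_deriveM_fun (is_deriveM_fun d1 d1) (d2 k))
      (is_deriveD_fun (is_deriveM_fun (c 2) (is_deriveM_fun d1 (d2 k.+1)))
         (is_deriveM_fun (c 2) (d2 k.+2))))).
  by apply: is_derive_eq h _; ring.
by rewrite (Rintegral_FTC lx cf Fd) /F !subrr !dpowS0; ring.
Qed.

Lemma Rintegral_dpow_tail (s r : R) k : s <= r ->
  \int[mu]_(t in `[s, r]) dpow k (r - t) = dpow k.+1 (r - s).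
Proof.
move=> sr; have cf : continuous (fun t => dpow k (r - t)).
  exact: continuous_dpow (@continuous_Blin r).
have Fd (t : R) : is_derive t 1 (fun t => (-1) * dpow k.+1 (r - t)) (dpow k (r - t)).
  have h := is_deriveM_fun (is_derive_cst_fun (-1) t) (is_derive_dpow k (is_derive_Blin r t)).
  by apply: is_derive_eq h _; ring.
by rewrite (Rintegral_FTC sr cf Fd) subrr dpowS0; ring.
Qed.

Lemma Rintegral_dpow_tail1 (s r : R) k : s <= r ->
  \int[mu]_(t in `[s, r]) (t * dpow k (r - t)) = s * dpow k.+1 (r - s) + dpow k.+2 (r - s).
Proof.
move=> sr; have cf : continuous (fun t : R => t * dpow k (r - t)).
  by move=> t; apply: cvgM; [exact: cvg_id|exact: (continuous_dpow (k := k) (@continuous_Blin r))].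
have Fd (t : R) : is_derive t 1
    (fun t => (-1) * (t * dpow k.+1 (r - t) + dpow k.+2 (r - t))) (t * dpow k (r - t)).
  have d j := is_derive_dpow j (is_derive_Blin r t).
  have h := is_deriveM_fun (is_derive_cst_fun (-1) t)
    (is_deriveD_fun (is_deriveM_fun (is_derive_id t 1) (d k)) (d k.+1)).
  by apply: is_derive_eq h _; rewrite /=; ring.
by rewrite (Rintegral_FTC sr cf Fd) subrr !dpowS0; ring.
Qed.

Lemma continuous_intgT (a b : R) (f : R -> R) : continuous f -> intg a b f.
Proof. by move=> cf; apply: continuous_intg; exact: continuous_subspaceT. Qed.

Lemma intgMT (a b : R) (f h : R -> R) : continuous h -> intg a b f ->
  intg a b (fun x => h x * f x).
Proof. by move=> ch; apply: intgMc; exact: continuous_subspaceT. Qed.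

(** Fubini moves [A] onto the weight, where two integrations raise the index by two. The kernel
    [s - t] is first split into [s] and [t], which gives the product form that [triangle_fubini]
    expects. *)
Lemma dpow_moment (r : R) (h : R -> R) k : 0 <= r -> intg 0 r h ->
  \int[mu]_(t in `[0, r]) (dpow k (r - t) * \int[mu]_(s in `[0, t]) ((s - t) * h s)) =
  - \int[mu]_(s in `[0, r]) (dpow k.+2 (r - s) * h s).
Proof.
move=> r0 hi.
have cw j : continuous (fun t : R => dpow j (r - t)) by exact: continuous_dpow (@continuous_Blin r).
have cid : continuous (fun t : R => t) by move=> t; exact: cvg_id.
have ctw j : continuous (fun t : R => t * dpow j (r - t)).
  by move=> t; apply: cvgM; [exact: cvg_id|exact: (cw j t)].
have shi : intg 0 r (fun s => s * h s) by exact: intgMT.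
have wi : intg 0 r (fun t => dpow k (r - t)) by exact: continuous_intgT.
have twi : intg 0 r (fun t => t * dpow k (r - t)) by exact: continuous_intgT.
transitivity (\int[mu]_(t in `[0, r]) (dpow k (r - t) * \int[mu]_(s in `[0, t]) (s * h s) -
   t * dpow k (r - t) * \int[mu]_(s in `[0, t]) h s)).
  apply: eq_Rintegral => t; rewrite inE/= in_itv/= => /andP[t0 tr].
  have -> : \int[mu]_(s in `[0, t]) ((s - t) * h s) =
      \int[mu]_(s in `[0, t]) (s * h s) - t * \int[mu]_(s in `[0, t]) h s.
    rewrite -RintegralZl//; last exact: intg_sub hi.
    rewrite -RintegralB//; [|exact: intg_sub shi|apply: intgZ; exact: intg_sub hi].
    by apply: eq_Rintegral => s _; rewrite mulrBl.
  by ring.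
have pc (g : R -> R) : intg 0 r g -> {within `[0, r], continuous (fun t => \int[mu]_(s in `[0, t]) g s)}.
  by move=> gi; exact: parameterized_integral_continuous.
have wc (f g : R -> R) : continuous f -> intg 0 r g ->
    intg 0 r (fun t => f t * \int[mu]_(s in `[0, t]) g s).
  by move=> cf gi; apply: continuous_intg; apply: wcontM (pc _ gi); exact: continuous_subspaceT.
rewrite RintegralB//; [|exact: wc|exact: wc].
rewrite (triangle_fubini shi wi) (triangle_fubini hi twi).
transitivity (\int[mu]_(s in `[0, r]) ((s * dpow k.+1 (r - s)) * h s) -
   \int[mu]_(s in `[0, r]) ((s * dpow k.+1 (r - s) + dpow k.+2 (r - s)) * h s)).
  congr (_ - _); apply: eq_Rintegral => s; rewrite inE/= in_itv/= => /andP[s0 sr].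
    by rewrite Rintegral_dpow_tail//; ring.
  by rewrite Rintegral_dpow_tail1// mulrC.
rewrite -RintegralB//; last 2 first.
- exact: intgMT.
- by apply: intgMT hi => t; apply: cvgD; [exact: (ctw k.+1 t)|exact: (cw k.+2 t)].
rewrite -mulN1r -RintegralZl//; last exact: intgMT.
by apply: eq_Rintegral => s _; ring.
Qed.

Lemma eq_ccont (a b : R) (f g : R -> C) : (forall x, a <= x <= b -> f x = g x) ->
  ccont a b f -> ccont a b g.
Proof.
move=> fg [f1 f2]; split.
  apply: subspace_eq_continuous f1 => x; rewrite inE/= in_itv/= => /fg e.
  exact: (congr1 (@cre R) e).
apply: subspace_eq_continuous f2 => x; rewrite inE/= in_itv/= => /fg e.
exact: (congr1 (@cim R) e).
Qed.

Lemma inL2_mxintg p r (f : fn R p) : inL2 r f -> mxintg 0 r f.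
Proof. by move=> fL i j; rewrite (ord1 j); exact: L2c_intg. Qed.

Lemma mxcont_inL2 p r (f : fn R p) : mxcont 0 r f -> inL2 r f.
Proof. by move=> fc i; exact: ccont_L2. Qed.

Lemma AopE p (f : fn R p) x i : Aop f x i 0 = cint 0 x (fun t => (t - x)%:C%C * f t i 0).
Proof. by rewrite mxE; apply: eq_cint => t _; rewrite mxE. Qed.

Lemma ccont_real a b (f : R -> R) : continuous f -> ccont a b (fun t => (f t)%:C%C).
Proof.
by move=> cf; split; apply: continuous_subspaceT => // x; exact: cvg_cst.
Qed.

Lemma Aop_ae p r (f g : fn R p) : inL2 r f -> inL2 r g -> aeeq r f g ->
  forall x, 0 <= x <= r -> Aop f x = Aop g x.
Proof.
move=> fL gL fg x /andP[x0 xr]; apply/matrixP => i j; rewrite (ord1 j) !AopE.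
have mc : ccont 0 x (fun t => (t - x)%:C%C).
  by apply: ccont_real; exact: continuous_linB.
apply: ae_eq_cint.
- by apply: cintgMc => //; apply: cintg_sub (L2c_intg (fL i)).
- by apply: cintgMc => //; apply: cintg_sub (L2c_intg (gL i)).
by apply: ae_imp fg => t h /andP[t0 tx]; rewrite h// t0 (le_trans tx).
Qed.

Lemma Aop_cont p r (f : fn R p) : 0 <= r -> inL2 r f -> mxcont 0 r (Aop f).
Proof.
move=> r0 /inL2_mxintg fi i j; rewrite (ord1 j); have fi0 := fi i 0.
have cid : continuous (fun t : R => t) by move=> t; exact: cvg_id.
have cr := ccont_real 0 r cid.
apply: (@eq_ccont _ _ (fun x => cint 0 x (fun t => t%:C%C * f t i 0) +
   (- 1) * (x%:C%C * cint 0 x (fun t => f t i 0)))); last first.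
  apply: ccontD; first exact: ccont_primitive (cintgMc cr fi0).
  by apply: ccontM; [exact: ccont_cst|apply: ccontM => //; exact: ccont_primitive].
move=> x /andP[x0 xr]; rewrite AopE mulN1r -mulNr.
rewrite -cintZ -?cintDe; last 3 first.
- exact: cintg_sub (cintgMc cr fi0).
- by apply: cintgZ; exact: cintg_sub fi0.
- exact: cintg_sub fi0.
by apply: eq_cint => t _; rewrite -mulrDl raddfB.
Qed.

Lemma Aop_inL2 p r (f : fn R p) : 0 <= r -> inL2 r f -> inL2 r (Aop f).
Proof. by move=> r0 fL; apply: mxcont_inL2; exact: Aop_cont. Qed.

Lemma iter_Aop_inL2 p r (f : fn R p) n : 0 <= r -> inL2 r f -> inL2 r (iter n (@Aop R p) f).
Proof. by move=> r0 fL; elim: n => //= n IH; exact: Aop_inL2. Qed.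

(** The index [k] is left general because each application of [A] shifts it by two in the
    induction. *)
Lemma iter_Aop_moment p r (f : fn R p) i n k : 0 <= r -> inL2 r f ->
  (\int[mu]_(t in `[0, r]) (dpow k (r - t) * cre (iter n (@Aop R p) f t i 0)) =
   (-1) ^+ n * \int[mu]_(t in `[0, r]) (dpow (n.*2 + k) (r - t) * cre (f t i 0))) /\
  (\int[mu]_(t in `[0, r]) (dpow k (r - t) * cim (iter n (@Aop R p) f t i 0)) =
   (-1) ^+ n * \int[mu]_(t in `[0, r]) (dpow (n.*2 + k) (r - t) * cim (f t i 0))).
Proof.
move=> r0 fL; elim: n k => [|n IH] k; first by rewrite expr0 !mul1r.
have [i1 i2] := L2c_intg (iter_Aop_inL2 n r0 fL i).
have [IH1 IH2] := IH k.+2.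
rewrite !exprS doubleS !addSn -!addnS -!mulrA -IH1 -IH2 !mulN1r -!dpow_moment//.
split; apply: eq_Rintegral => t _; rewrite iterS AopE; congr (_ * _).
  by rewrite /cint [LHS]/=; apply: eq_Rintegral => s _; rewrite creM /= mul0r subr0.
by rewrite /cint [LHS]/=; apply: eq_Rintegral => s _; rewrite cimM /= mul0r addr0.
Qed.

End Volterra.

(** * Sharp growth of [K^n g] and triangularity of the inverse of [E] *)

Section Causality.
Variable R : realType.
Local Notation C := (R[i]).
Local Notation mu := (@lebesgue_measure R).
Local Notation intg a b f := (mu.-integrable `[a, b] (EFin \o f)).

Lemma Kop_cont p r (b : R -> 'M[C]_(p, p + p)) (f : fn R p) : 0 <= r ->
  mxcont 0 r b -> inL2 r f -> mxcont 0 r (Kop b f).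
Proof.
move=> r0 bc /inL2_mxintg fi; apply: mxcont_scale; apply: mxcont_mul.
  by apply: mxcont_mul => //; exact: mxcont_cst.
by apply: mxcont_primitive => //; apply: mxintg_mul => //; exact: mxcont_adj.
Qed.

Lemma mxintg_sub m n a b c d (G : R -> 'M[C]_(m, n)) : a <= c -> d <= b ->
  mxintg a b G -> mxintg c d G.
Proof. by move=> ac db Gi i j; exact: cintg_sub (Gi i j). Qed.

Lemma KopE p r (b : R -> 'M[C]_(p, p + p)) (f : fn R p) x : mxcont 0 r b -> inL2 r f ->
  x <= r -> mxintg 0 x (fun t => Kker b x t *m f t) /\
  Kop b f x = cintmx 0 x (fun t => Kker b x t *m f t).
Proof.
move=> bc /inL2_mxintg fi xr.
have bfi : mxintg 0 x (fun t => mxadj (b t) *m f t).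
  by apply: (@mxintg_sub _ _ 0 r) => //; apply: mxintg_mul => //; exact: mxcont_adj.
have bfi2 : mxintg 0 x (fun t => b x *m Jmx R p *m (mxadj (b t) *m f t)).
  by apply: mxintg_mul => //; exact: mxcont_cst.
split.
  move=> i j; apply: eq_cintg (cintgZ (iC R) (bfi2 i j)) => t _.
  by rewrite /Kker -scalemxAl mulmxA [RHS]mxE.
rewrite /Kop cintmx_mull// cintmx_scale//; apply: eq_cintmx => t _.
by rewrite /Kker -scalemxAl mulmxA.
Qed.

Lemma Rintegral_zero_left (l x : R) (f : R -> R) : 0 <= l ->
  (forall t, 0 <= t <= l -> f t = 0) ->
  \int[mu]_(t in `[0, x]) f t = \int[mu]_(t in `[l, x]) f t.
Proof.
move=> l0 f0; have -> : `[l, x]%classic = `[0, x] `&` `[l, x] :> set R.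
  by apply/esym/setIidPr; apply: subset_itvr; rewrite bnd_simp.
rewrite Rintegral_mkcondr; apply: eq_Rintegral => t; rewrite inE/= in_itv/= => /andP[t0 tx].
rewrite patchE; case: ifPn => //; rewrite notin_setE/= in_itv/= tx andbT => /negP.
by rewrite -ltNge => tl; rewrite f0// t0 ltW.
Qed.

Lemma cint0 (a b : R) : cint a b (fun _ => 0 : C) = 0.
Proof. by congr Complex; rewrite [LHS]Rintegral_cst// mul0r. Qed.

Lemma cint_bound (l x : R) (f : R -> C) (G : R -> R) : 0 <= l ->
  cintg 0 x f -> intg l x G -> (forall t, 0 <= t <= l -> f t = 0) ->
  (forall t, l <= t <= x -> cbnd (f t) (G t)) ->
  cbnd (cint 0 x f) (\int[mu]_(t in `[l, x]) G t).
Proof.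
move=> l0 [f1 f2] Gi f0 fG; split; rewrite /cint /=.
  rewrite (Rintegral_zero_left _ l0) => [|t /f0->//].
  by apply: Rintegral_bound => //; [exact: intg_sub f1|move=> t /fG[]].
rewrite (Rintegral_zero_left _ l0) => [|t /f0->//].
by apply: Rintegral_bound => //; [exact: intg_sub f2|move=> t /fG[]].
Qed.

Lemma cbnd_real (a : R) (z : C) M : 0 <= a -> cbnd z M -> cbnd (a%:C%C * z) (a * M).
Proof.
move=> a0 [h1 h2]; split; rewrite ?creM ?cimM /= mul0r ?subr0 ?addr0 normrM ger0_norm// ler_wpM2l//.
Qed.

Lemma cbndN (z : C) M : cbnd z M -> cbnd (- z) M.
Proof. by move=> [h1 h2]; split; rewrite ?creN ?cimN normrN. Qed.

(* The factor tends to [1 + 2 p N eta] as [k] grows, and [eta] is arbitrary: this is what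
   makes the growth rate of [K^n g] sharp. *)
Lemma Kop_step p r l (b : R -> 'M[C]_(p, p + p)) (g : fn R p) (N eta D : R) k :
  mxcont 0 r b -> 0 < eta -> 0 <= N -> 0 <= l -> 0 <= D ->
  (forall t x, 0 <= t -> t <= x -> x <= r -> forall i j,
     cbnd ((Kker b x t + (x - t)%:C%C *: 1%:M) i j) ((x - t) * (N * (eta + (x - t) / eta)))) ->
  inL2 r g -> (forall t, 0 <= t <= l -> g t = 0) ->
  (forall t, l <= t <= r -> forall i, cbnd (g t i 0) (D * dpow k (t - l))) ->
  (forall t, 0 <= t <= l -> t <= r -> Kop b g t = 0) /\
  (forall x, l <= x <= r -> forall i, cbnd (Kop b g x i 0)
     (D * (1 + 2 * p%:R * N * eta + (4 * p%:R * N * r / eta) / k.+3%:R) * dpow k.+2 (x - l))).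
Proof.
move=> bc e0 N0 l0 D0 HK gL g0 gb; split.
  move=> x /andP[x0 xl] xr; have [_ ->] := KopE bc gL xr.
  rewrite (@eq_cintmx _ _ _ _ _ _ (fun _ => 0)).
    apply/matrixP => i j; rewrite mxE [RHS]mxE -[RHS](cint0 0 x).
    by apply: eq_cint => t _; rewrite mxE.
  by move=> t /andP[t0 tx]; rewrite g0 ?mulmx0// t0 (le_trans tx).
move=> x /andP[lx xr] i; have [Ki ->] := KopE bc gL xr; rewrite mxE.
(* [A] collects the exact part, with coefficient 1, and the [eta] part of the kernel remainder; [B]
   is the coefficient of [(x - t)^2 / eta]. The latter integrates to a divided power one index
   higher, which supplies the factor [1 / (k + 3)]. *)
pose A := D * (1 + 2 * p%:R * N * eta); pose B := D * (2 * p%:R * N / eta).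
pose G t := (A * (x - t) + B * (x - t) ^+ 2) * dpow k (t - l).
have Gc : continuous G.
  move=> t; apply: cvgM; last exact: (continuous_dpow (k := k) (@continuous_linB R l)).
  apply: cvgD; apply: cvgM; [exact: cvg_cst|exact: continuous_Blin|exact: cvg_cst|].
  exact: (continuousX (n := 2) (@continuous_Blin R x)).
have : cbnd (cint 0 x (fun t => (Kker b x t *m g t) i 0)) (\int[mu]_(t in `[l, x]) G t).
  apply: cint_bound => //; first exact: continuous_intgT.
    by move=> t /g0 ->; rewrite mulmx0 mxE.
  move=> t /andP[lt tx]; have t0 := le_trans l0 lt.
  have xt : 0 <= x - t by rewrite subr_ge0.
  have gt : forall j, cbnd (g t j 0) (D * dpow k (t - l)).
    by move=> j; apply: gb; rewrite lt (le_trans tx).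
  (* The scalar part [-(x - t)] is split off before estimating: summed entrywise it would cost a
     factor [2 p] instead of 1. *)
  have -> : (Kker b x t *m g t) i 0 =
      ((Kker b x t + (x - t)%:C%C *: 1%:M) *m g t) i 0 + - ((x - t)%:C%C * g t i 0).
    by rewrite mulmxDl -scalemxAl mul1mx [in RHS]mxE [X in _ + X - _]mxE addrK.
  rewrite [X in cbnd (X + _)]mxE.
  have := cbndD (cbnd_sum (fun j => cbndM (HK t x t0 tx xr i j) (gt j)))
    (cbndN (cbnd_real xt (gt i))).
  apply: cbnd_le; rewrite /G /A /B le_eqVlt; apply/orP; left; apply/eqP.
  by field; rewrite gt_eqF.
apply: cbnd_le; rewrite /G Rintegral_dpow// (dpowS k.+2).
have P0 : 0 <= dpow k.+2 (x - l) by rewrite dpow_ge0// subr_ge0.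
rewrite [X in X <= _](_ : _ = D * (1 + 2 * p%:R * N * eta +
   (4 * p%:R * N * (x - l) / eta) / k.+3%:R) * dpow k.+2 (x - l)); last first.
  have : (k.+3%:R : R) != 0 by rewrite pnatr_eq0.
  move: (k.+3%:R : R) => kk kk0.
  by rewrite /A /B; field; rewrite kk0 (gt_eqF e0).
rewrite ler_wpM2r// ler_wpM2l// lerD2l ler_wpM2r ?invr_ge0// ler_wpM2r ?invr_ge0 ?(ltW e0)//.
rewrite ler_wpM2l ?mulr_ge0//; lra.
Qed.

(** From some index [n0] on, the factor is at most [th]. [M] is the sum of the ratios [u i / th^i]
    for [i <= n0], hence at least each of them. *)
Lemma geometric_growth (u : nat -> R) (e a th : R) : 0 <= e -> 0 <= a -> 1 + e < th ->
  (forall n, 0 <= u n) -> (forall n, u n.+1 <= u n * (1 + e + a / n.+1%:R)) ->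
  exists2 M, 0 <= M & forall n, u n <= M * th ^+ n.
Proof.
move=> e0 a0 eth u0 uS; have th0 : 0 < th by lra.
pose d := th - (1 + e); have d0 : 0 < d by rewrite /d; lra.
pose n0 := (Num.truncn (a / d)).+1.
have n0P n : (n0 <= n)%N -> 1 + e + a / n.+1%:R <= th.
  move=> hn; have : a / d < n.+1%:R.
    apply: (@lt_le_trans _ _ n0%:R); first by rewrite truncnS_gt// divr_ge0// ltW.
    by rewrite ler_nat (leq_trans hn).
  rewrite ltr_pdivrMr// mulrC -ltr_pdivrMr ?ltr0n// /d; set q := a / _; lra.
exists (\sum_(i < n0.+1) u i / th ^+ i).
  by apply: sumr_ge0 => i _; rewrite divr_ge0// exprn_ge0// ltW.
elim=> [|n IH].
  rewrite expr0 mulr1 big_ord_recl expr0 divr1 lerDl sumr_ge0// => i _.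
  by rewrite divr_ge0// exprn_ge0// ltW.
have [hn|hn] := leqP n0 n.
  rewrite (le_trans (uS n))// exprSr mulrA ler_pM//.
    by rewrite !addr_ge0// divr_ge0.
  exact: n0P.
have hn' : (n.+1 < n0.+1)%N by rewrite ltnS.
rewrite -ler_pdivrMr ?exprn_gt0// (bigD1 (Ordinal hn'))//= lerDl sumr_ge0// => i _.
by rewrite divr_ge0// exprn_ge0// ltW.
Qed.

Lemma ae_ord n (P : 'I_n -> R -> Prop) : (forall i, {ae mu, forall x, P i x}) ->
  {ae mu, forall x, forall i, P i x}.
Proof. by move=> h; apply: (@filter_forall _ _ _ _ (ae_filter_ringOfSetsType mu)). Qed.

(** The choice of parameter makes both terms linear in [B], so the growth rate of the norms passes
    unchanged to the integrals. *)
Lemma weighted_bound (r W B S : R) (w z : R -> R) : 0 <= r -> 0 < B -> continuous w ->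
  (forall t, 0 <= t <= r -> `|w t| <= W) -> intg 0 r z -> intg 0 r (fun t => z t ^+ 2) ->
  \int[mu]_(t in `[0, r]) (z t ^+ 2) <= S * B ^+ 2 ->
  `|\int[mu]_(t in `[0, r]) (w t * z t)| <= B * (S + W ^+ 2 * r).
Proof.
move=> r0 B0 cw wW zi z2i zS.
apply: (@le_trans _ _ (\int[mu]_(t in `[0, r]) (B^-1 * z t ^+ 2 + B * W ^+ 2))).
  apply: Rintegral_bound; first exact: intgMT.
    by apply: intgD; [exact: intgZ|exact: intg_cst].
  move=> t /wW wt; rewrite normrM.
  have W0 : 0 <= W := le_trans (normr_ge0 _) wt.
  apply: (@le_trans _ _ (W * `|z t|)); first by rewrite ler_wpM2r.
  rewrite -(real_normK (num_real (z t))); set a := `|z t|.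
  have a0 : 0 <= a := normr_ge0 _.
  have h : 0 <= B^-1 * ((a - B * W) ^+ 2 + a * (B * W)).
    by rewrite mulr_ge0 ?invr_ge0 ?(ltW B0)// addr_ge0 ?sqr_ge0// mulr_ge0// mulr_ge0// ltW.
  have e : B^-1 * ((a - B * W) ^+ 2 + a * (B * W)) = B^-1 * a ^+ 2 + B * W ^+ 2 - W * a.
    by field; rewrite gt_eqF.
  by rewrite e subr_ge0 in h.
rewrite RintegralD//; [|exact: intgZ|exact: intg_cst].
rewrite Rintegral_itv_cst// RintegralZl// subr0 mulrDr mulrA lerD2r.
rewrite ler_pdivrMl// (le_trans zS)// le_eqVlt; apply/orP; left; apply/eqP; ring.
Qed.

Section iterates.
Variables (p : nat) (r l : R) (b b1 : R -> 'M[C]_(p, p + p)) (Einv : fn R p -> fn R p).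
Variables (g : fn R p) (D : R).
Hypotheses (r0 : 0 < r) (l0 : 0 <= l) (lr : l <= r) (bU : classU r b b1).
Hypothesis bJb : forall x, 0 <= x <= r -> b x *m Jmx R p *m mxadj (b x) = 0.
Hypothesis b1Jb : forall x, 0 <= x <= r -> b1 x *m Jmx R p *m mxadj (b x) = iC R *: 1%:M.
Hypothesis Einv_bounded : bounded_op r Einv.
Hypothesis EinvK : forall f, inL2 r f -> aeeq r (Einv (Kop b f)) (Aop (Einv f)).
Hypothesis gL : inL2 r g.
Hypothesis g0 : forall t, 0 <= t <= l -> g t = 0.
Hypothesis D0 : 0 < D.
Hypothesis gD : forall t, l <= t <= r -> forall i, cbnd (g t i 0) D.

Let bc : mxcont 0 r b. Proof. exact: deriv_on_cont bU.1. Qed.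
Let r0' : 0 <= r. Proof. exact: ltW. Qed.

Lemma iter_Kop_inL2 n : inL2 r (iter n (Kop b) g).
Proof. by elim: n => //= n IH; apply: mxcont_inL2; exact: Kop_cont. Qed.

Lemma iter_intertwine n : aeeq r (Einv (iter n (Kop b) g)) (iter n (@Aop R p) (Einv g)).
Proof.
have EL f : inL2 r f -> inL2 r (Einv f) by apply: Einv_bounded.1.
elim: n => [|n IH]; first by apply: aeW.
apply: ae_imp (EinvK (iter_Kop_inL2 n)) => x /= h xr; rewrite h// {h}.
by apply: Aop_ae IH _ xr; [exact/EL/iter_Kop_inL2|exact/iter_Aop_inL2/EL].
Qed.

Lemma iter_Kop_bound tau : 1 < tau -> exists2 Dn : nat -> R,
  (exists2 M, 0 <= M & forall n, Dn n <= M * tau ^+ n) &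
  forall n, [/\ 0 < Dn n, (forall t, 0 <= t <= l -> iter n (Kop b) g t = 0) &
   forall t, l <= t <= r -> forall i,
     cbnd (iter n (Kop b) g t i 0) (Dn n * dpow n.*2 (t - l))].
Proof.
move=> tau1; have [N N0 HN] := Kker_bound bU bJb b1Jb.
pose e := (tau - 1) / 2; have e0 : 0 < e by rewrite /e; lra.
(* Small enough that [2 p N eta <= e]; the summand 1 keeps the denominator positive. *)
pose eta := e / (2 * p%:R * N + 1).
have pN : 0 <= 2 * p%:R * N by rewrite !mulr_ge0.
have eta0 : 0 < eta by rewrite divr_gt0// ltr_wpDl.
pose a := 4 * p%:R * N * r / eta.
have a0 : 0 <= a by rewrite divr_ge0 ?(ltW eta0)// !mulr_ge0.
(* The factor of [Kop_step] at [k = 2n], the index reached after [n] applications of [K]. *)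
pose q n := 1 + 2 * p%:R * N * eta + a / n.*2.+3%:R.
pose Dn := fix Dn n := if n is m.+1 then Dn m * q m else D.
have q0 n : 0 < q n.
  rewrite /q -addrA ltr_pwDl// addr_ge0//; last by rewrite divr_ge0.
  by rewrite mulr_ge0// ltW.
have Dn0 n : 0 < Dn n by elim: n => //= n IH; rewrite mulr_gt0.
exists Dn.
  apply: (@geometric_growth Dn e a tau) => //; [exact: ltW|by rewrite /e; lra|by move=> n; exact: ltW|].
  move=> n /=; rewrite ler_wpM2l ?(ltW (Dn0 n))// lerD//.
    rewrite lerD2l /eta mulrA ler_pdivrMr ?ltr_wpDl// mulrDr mulr1 [X in _ <= X + _]mulrC.
    by rewrite lerDl ltW.
  rewrite ler_wpM2l// lef_pV2 ?posrE ?ltr0n// ler_nat.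
  by rewrite -addnn -addn3 -addnA -[X in (X < _)%N]addn0 ltn_add2l addn3.
elim=> [|n [_ IH0 IHb]].
  by split=> // t tlr i; rewrite dpow0 mulr1; exact: gD.
have [K0 Kb] := Kop_step bc eta0 N0 l0 (ltW (Dn0 n)) (fun t x => HN eta t x eta0)
   (iter_Kop_inL2 n) IH0 IHb.
split=> //; first by move=> t tl; apply: K0 => //; case/andP: tl => _ /le_trans; apply.
Qed.

Lemma cbnd_cabs2 (z : C) M : cbnd z M -> cabs2 z <= 2 * M ^+ 2.
Proof.
move=> [h1 h2]; have M0 := le_trans (normr_ge0 _) h1.
rewrite mulr_natl mulr2n /cabs2 -(real_normK (num_real (cre z))) -(real_normK (num_real (cim z))).
by rewrite lerD// lerXn2r// nnegrE.
Qed.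

Lemma nrm2_bound (f : fn R p) B : inL2 r f ->
  (forall t, 0 <= t <= r -> forall i, cbnd (f t i 0) B) ->
  nrm2 r f <= p%:R * (2 * B ^+ 2 * r).
Proof.
move=> fL fB; rewrite mulr_natl -[in leRHS](card_ord p) -sumr_const.
apply: ler_sum => i _; rewrite -[X in _ * X](subr0 r) -Rintegral_itv_cst//.
apply: le_Rintegral => //; [by have [_ []] := fL i|exact: intg_cst|].
by move=> t /=; rewrite in_itv/= => /fB/(_ i)/cbnd_cabs2.
Qed.

Lemma comp_le_nrm2 (f : fn R p) i : inL2 r f ->
  \int[mu]_(t in `[0, r]) (cre (f t i 0) ^+ 2) <= nrm2 r f /\
  \int[mu]_(t in `[0, r]) (cim (f t i 0) ^+ 2) <= nrm2 r f.
Proof.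
move=> fL; have [s1 s2] := L2c_sq (fL i); have [_ [_ s3]] := fL i.
have le : \int[mu]_(t in `[0, r]) cabs2 (f t i 0) <= nrm2 r f.
  rewrite /nrm2 (bigD1 i)//= lerDl sumr_ge0// => j _.
  by apply: Rintegral_ge0 => t _; exact: cabs2_ge0.
by split; apply: le_trans le; apply: le_Rintegral => // t _; rewrite /cabs2 ?lerDl ?lerDr sqr_ge0.
Qed.

(** The function [A^n E^-1 g = E^-1 K^n g] is paired with [r - t]. On the [A] side this is, up to
    sign, the moment of order [2n + 1] divided by [(2n + 1)!]; on the [K] side it is bounded by a
    multiple of [Dn n * rho0^(2n) / (2n)!]. One factor [r - t] stays with [E^-1 g], which leaves the
    even powers required by [moment_vanish]. *)
Lemma Einv_moment (rho : R) : r - l < rho -> exists M : R, forall n i,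
  `|\int[mu]_(t in `[0, r]) ((r - t) ^+ n.*2 * ((r - t) * cre (Einv g t i 0)))| <= M * rho ^+ n.*2 /\
  `|\int[mu]_(t in `[0, r]) ((r - t) ^+ n.*2 * ((r - t) * cim (Einv g t i 0)))| <= M * rho ^+ n.*2.
Proof.
move=> crho; pose rho0 := (r - l + rho) / 2.
have lr' := lr; have rho00 : 0 < rho0 by rewrite /rho0; lra.
have crho0 : r - l < rho0 by rewrite /rho0; lra.
(* [rho^(2n)] is [rho0^(2n)] times [tau^n] twice: one [tau^n] pays for the growth of [Dn], the other
   for the quotient [2n + 1] of the two factorials. *)
pose tau := rho / rho0; have tau1 : 1 < tau by rewrite /tau ltr_pdivlMr// mul1r /rho0; lra.
have [Dn [M2 M20 HM2] HDn] := iter_Kop_bound tau1.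
have [M3 M30 HM3] : exists2 M, 0 <= M & forall n, (n.*2.+1)%:R <= M * tau ^+ n.
  apply: (@geometric_growth (fun n => (n.*2.+1)%:R : R) 0 2 tau) => //; first by rewrite addr0.
  move=> n; rewrite addr0 mulrDr mulr1 doubleS -[n.*2.+3]addn2 natrD lerD2l.
  rewrite mulrA ler_pdivlMr ?ltr0n// -!natrM ler_nat mulnC leq_pmul2r//.
  by rewrite ltnS -addnn leq_addr.
have [EL [_ [_ [M0 HM0]]]] := Einv_bounded.
(* The operator bound [M0] comes without a sign, hence the absolute value. *)
pose S := `|M0| * (p%:R * (2 * r)).
exists ((S + r ^+ 2 * r) * (M2 * M3)) => n i.
have [Dn0 gn0 gnb] := HDn n.
pose B := Dn n * dpow n.*2 rho0.
have dp0 : 0 < dpow n.*2 rho0 by rewrite /dpow divr_gt0 ?exprn_gt0// ltr0n fact_gt0.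
have B0 : 0 < B by rewrite mulr_gt0.
have gL' := iter_Kop_inL2 n; have EgL := EL _ gL'.
have nB : nrm2 r (Einv (iter n (Kop b) g)) <= S * B ^+ 2.
  have h : nrm2 r (iter n (Kop b) g) <= p%:R * (2 * B ^+ 2 * r).
    apply: nrm2_bound => // t /andP[t0 tr] j; have [tl|lt] := leP t l.
      by rewrite gn0 ?t0// mxE; split; rewrite ?cre0 ?cim0 normr0 ltW.
    apply: cbnd_le (gnb t _ j); last by rewrite (ltW lt).
    rewrite /B ler_pM2l// /dpow ler_pM2r ?invr_gt0 ?ltr0n ?fact_gt0//.
    by rewrite lerXn2r// ?nnegrE; lra.
  have n0 : 0 <= nrm2 r (iter n (Kop b) g).
    by apply: sumr_ge0 => j _; apply: Rintegral_ge0 => t _; exact: cabs2_ge0.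
  rewrite (le_trans (HM0 _ gL'))// (le_trans (ler_wpM2r n0 (ler_norm M0)))//.
  rewrite /S -mulrA ler_wpM2l// (le_trans h)// le_eqVlt; apply/orP; left; apply/eqP; ring.
have [c1 c2] := comp_le_nrm2 i EgL.
have [s1 s2] := L2c_sq (EgL i); have [i1 i2] := L2c_intg (EgL i).
have cw := @continuous_Blin R r.
have wW t : 0 <= t <= r -> `|r - t| <= r.
  by move=> /andP[t0 tr]; rewrite ger0_norm ?subr_ge0// gerBl.
have b1' := weighted_bound r0' B0 cw wW i1 s1 (le_trans c1 nB).
have b2' := weighted_bound r0' B0 cw wW i2 s2 (le_trans c2 nB).
have fL := EL _ gL.
have [j1 j2] := L2c_intg (iter_Aop_inL2 n r0' fL i).
have [m1 m2] := iter_Aop_moment i n 1 r0' fL.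
have fin (F Z G : R -> R) : intg 0 r F -> intg 0 r Z -> intg 0 r G ->
    {ae mu, forall t, 0 <= t <= r -> Z t = F t} ->
    `|\int[mu]_(t in `[0, r]) ((r - t) * Z t)| <= B * (S + r ^+ 2 * r) ->
    \int[mu]_(t in `[0, r]) (dpow 1 (r - t) * F t) =
      (-1) ^+ n * \int[mu]_(t in `[0, r]) (dpow (n.*2 + 1) (r - t) * G t) ->
    `|\int[mu]_(t in `[0, r]) ((r - t) ^+ n.*2 * ((r - t) * G t))| <=
      (S + r ^+ 2 * r) * (M2 * M3) * rho ^+ n.*2.
  move=> Fi Zi Gi ZF bd mom.
  have eZ : \int[mu]_(t in `[0, r]) ((r - t) * Z t) = \int[mu]_(t in `[0, r]) (dpow 1 (r - t) * F t).
    transitivity (\int[mu]_(t in `[0, r]) ((r - t) * F t)).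
      apply: ae_eq_Rintegral; [exact: intgMT|exact: intgMT|].
      by apply: ae_imp ZF => t h /h ->.
    by apply: eq_Rintegral => t _; rewrite dpow1.
  rewrite eZ mom normrM normrX normrN1 expr1n mul1r in bd.
  have -> : \int[mu]_(t in `[0, r]) ((r - t) ^+ n.*2 * ((r - t) * G t)) =
      (n.*2.+1)`!%:R * \int[mu]_(t in `[0, r]) (dpow (n.*2 + 1) (r - t) * G t).
    rewrite -RintegralZl//; last by apply: intgMT => //; exact: continuous_dpow.
    apply: eq_Rintegral => t _; rewrite addn1 /dpow exprSr; field.
    by rewrite pnatr_eq0 -lt0n fact_gt0.
  rewrite normrM ger0_norm ?ler0n//.
  apply: le_trans (ler_wpM2l (ler0n _ _) bd) _.
  have -> : (n.*2.+1)`!%:R * (B * (S + r ^+ 2 * r)) =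
      (S + r ^+ 2 * r) * (Dn n * (n.*2.+1)%:R) * rho0 ^+ n.*2.
    rewrite /B /dpow factS natrM; field.
    by rewrite pnatr_eq0 -lt0n fact_gt0.
  have -> : rho ^+ n.*2 = (tau ^+ n * tau ^+ n) * rho0 ^+ n.*2.
    by rewrite -exprD addnn -exprMn /tau divfK// gt_eqF.
  rewrite [X in _ <= X]mulrA ler_wpM2r ?exprn_ge0 ?(ltW rho00)//.
  rewrite -[X in _ <= X]mulrA ler_wpM2l//; first by rewrite addr_ge0// !mulr_ge0// exprn_ge0.
  by rewrite [X in _ <= X]mulrACA ler_pM// ltW.
have iw := iter_intertwine n.
have [k1 k2] := L2c_intg (fL i).
split; [apply: (fin _ _ _ j1 i1 k1 _ b1' m1)|apply: (fin _ _ _ j2 i2 k2 _ b2' m2)];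
  by apply: ae_imp iw => t h /h ->.
Qed.

Lemma causal_vanish : aeeq l (Einv g) (fun _ => 0).
Proof.
have fL := Einv_bounded.1 _ gL.
have van (G : R -> R) : intg 0 r G ->
    (forall rho : R, r - l < rho -> exists M : R, forall n,
      `|\int[mu]_(t in `[0, r]) ((r - t) ^+ n.*2 * ((r - t) * G t))| <= M * rho ^+ n.*2) ->
    {ae mu, forall x, 0 <= x <= l -> (r - x) * G x = 0}.
  move=> Gi Gm; have Hi : intg 0 r (fun t => (r - t) * G t).
    by apply: intgMT => //; exact: continuous_Blin.
  apply: ae0_of_Rintegral0; first exact: intg_sub Hi.
  (* The moment bounds require [rho > r - l] and [moment_vanish] requires [rho < r - x]; the
     midpoint satisfies both because [x < l]. *)
  move=> x /andP[x0 xl]; pose rho := (r - l + (r - x)) / 2.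
  have [|M HM] := Gm rho; first by rewrite /rho; lra.
  by have lr' := lr; apply: (moment_vanish _ Hi HM); rewrite // /rho; lra.
have re i : {ae mu, forall x, 0 <= x <= l -> (r - x) * cre (Einv g x i 0) = 0}.
  apply: van; first by have [] := L2c_intg (fL i).
  by move=> rho /Einv_moment[M HM]; exists M => n; case: (HM n i).
have im i : {ae mu, forall x, 0 <= x <= l -> (r - x) * cim (Einv g x i 0) = 0}.
  apply: van; first by have [] := L2c_intg (fL i).
  by move=> rho /Einv_moment[M HM]; exists M => n; case: (HM n i).
(* The weight [r - x] has to be cancelled, and it vanishes at [r], which belongs to [[0, l]] when
   [l = r]. *)
have xr : {ae mu, forall x, x != r}.
  exists [set r]; split => //; first exact: lebesgue_measure_set1.
  by move=> x /=; apply: contra_notP => /eqP.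
apply: ae_imp (ae_and xr (ae_and (ae_ord re) (ae_ord im))) => x [xr' [hre him]] xl.
have rx : r - x != 0 by rewrite subr_eq0 eq_sym.
apply/matrixP => i j; rewrite (ord1 j) [RHS]mxE; apply: ceqP.
  by apply/eqP; have /eqP := hre i xl; rewrite mulf_eq0 (negbTE rx).
by apply/eqP; have /eqP := him i xl; rewrite mulf_eq0 (negbTE rx).
Qed.

End iterates.

End Causality.

(** * Differentiation of matrix functions and solutions of the canonical system *)

Section Canonical.
Variable R : realType.
Local Notation C := (R[i]).
Local Notation mu := (@lebesgue_measure R).
Local Notation intg a b f := (mu.-integrable `[a, b] (EFin \o f)).

Definition cder (f : R -> C) (x : R) (d : C) :=
  is_derive x 1 (fun y => cre (f y)) (cre d) /\ is_derive x 1 (fun y => cim (f y)) (cim d).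

Lemma eq_is_derive (f g : R -> R) (x d e : R) : f =1 g -> d = e ->
  is_derive x 1 f d -> is_derive x 1 g e.
Proof. by move=> /funext -> ->. Qed.

Lemma cder_cst (c : C) x : cder (fun _ => c) x 0.
Proof. by split; exact: is_derive_cst_fun. Qed.

Lemma cderD f g x d e : cder f x d -> cder g x e -> cder (fun y => f y + g y) x (d + e).
Proof.
move=> [f1 f2] [g1 g2]; split.
  by apply: eq_is_derive (is_deriveD_fun f1 g1) => [y|]; rewrite creD.
by apply: eq_is_derive (is_deriveD_fun f2 g2) => [y|]; rewrite cimD.
Qed.

Lemma is_deriveN_fun (f : R -> R) (t df : R) : is_derive t 1 f df ->
  is_derive t 1 (fun s => - f s) (- df).
Proof. by move=> hf; exact: is_deriveN. Qed.

Lemma cderM f g x d e : cder f x d -> cder g x e ->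
  cder (fun y => f y * g y) x (d * g x + f x * e).
Proof.
move=> [f1 f2] [g1 g2]; split.
  have h := is_deriveD_fun (is_deriveM_fun f1 g1) (is_deriveN_fun (is_deriveM_fun f2 g2)).
  by apply: eq_is_derive h => [y|]; rewrite ?creD !creM//; ring.
have h := is_deriveD_fun (is_deriveM_fun f1 g2) (is_deriveM_fun f2 g1).
by apply: eq_is_derive h => [y|]; rewrite ?cimD !cimM//; ring.
Qed.

Lemma cder_conj f x d : cder f x d -> cder (fun y => conjc (f y)) x (conjc d).
Proof.
move=> [f1 f2]; split.
  by apply: eq_is_derive f1 => [y|]; rewrite cre_conj.
by apply: eq_is_derive (is_deriveN_fun f2) => [y|]; rewrite cim_conj.
Qed.

Lemma eq_cder f g x d e : f =1 g -> d = e -> cder f x d -> cder g x e.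
Proof. by move=> /funext -> ->. Qed.

Lemma cder_sum n (F : 'I_n -> R -> C) x (d : 'I_n -> C) : (forall i, cder (F i) x (d i)) ->
  cder (fun y => \sum_(i < n) F i y) x (\sum_(i < n) d i).
Proof.
elim: n F d => [|n IH] F d Fd.
  by apply: eq_cder (cder_cst 0 x) => [y|]; rewrite big_ord0.
have h := cderD (IH _ _ (fun i => Fd (widen_ord (leqnSn n) i))) (Fd ord_max).
by apply: eq_cder h => [y|]; rewrite big_ord_recr.
Qed.

Definition mxder m n (F : R -> 'M[C]_(m, n)) (x : R) (D : 'M[C]_(m, n)) :=
  forall i j, cder (fun y => F y i j) x (D i j).

Lemma mxder_mul m n q (F : R -> 'M[C]_(m, n)) (G : R -> 'M[C]_(n, q)) x D E :
  mxder F x D -> mxder G x E -> mxder (fun y => F y *m G y) x (D *m G x + F x *m E).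
Proof.
move=> Fd Gd i j; have h := cder_sum (fun k => cderM (Fd i k) (Gd k j)).
by apply: eq_cder h => [y|]; rewrite !mxE// -big_split.
Qed.

Lemma mxder_cst m n (M : 'M[C]_(m, n)) x : mxder (fun _ => M) x 0.
Proof. by move=> i j; rewrite mxE; exact: cder_cst. Qed.

Lemma mxder_adj m n (F : R -> 'M[C]_(m, n)) x D : mxder F x D ->
  mxder (fun y => mxadj (F y)) x (mxadj D).
Proof.
by move=> Fd i j; apply: eq_cder (cder_conj (Fd j i)) => [y|]; rewrite !mxE.
Qed.

Lemma mxderD m n (F G : R -> 'M[C]_(m, n)) x D E : mxder F x D -> mxder G x E ->
  mxder (fun y => F y + G y) x (D + E).
Proof. by move=> Fd Gd i j; apply: eq_cder (cderD (Fd i j) (Gd i j)) => [y|]; rewrite mxE. Qed.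

Lemma deriv_on_mxder m n r (F D : R -> 'M[C]_(m, n)) x : deriv_on r F D -> 0 < x < r ->
  mxder F x (D x).
Proof.
move=> Fd x0r; have x0r' : 0 <= x <= r by case/andP: x0r => h1 h2; rewrite !ltW.
move=> i j; split; apply: (wderiv_is_derive x0r).
  exact: (deriv_on_re (i := i) (j := j) Fd).
exact: (deriv_on_im (i := i) (j := j) Fd).
Qed.

Lemma is_derive_primitive (l x : R) (f : R -> R) : {within `[0, l], continuous f} ->
  0 < x -> x < l -> is_derive x 1 (fun y => \int[mu]_(t in `[0, y]) f t) (f x).
Proof.
move=> cf x0 xl; have fi := continuous_intg cf.
have cx : {for x, continuous f}.
  by apply: (within_continuous_continuous (lt_trans x0 xl) cf); rewrite in_itv/= x0.
have [d1 d2] := continuous_FTC1_closed xl fi x0 cx.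
by split=> //; rewrite -derive1E.
Qed.

Lemma mxder_primitive m n l x (G : R -> 'M[C]_(m, n)) : mxcont 0 l G -> 0 < x -> x < l ->
  mxder (fun y => cintmx 0 y G) x (G x).
Proof.
move=> Gc x0 xl i j; have [c1 c2] := Gc i j; split.
  apply: eq_is_derive (is_derive_primitive c1 x0 xl) => // y; by rewrite mxE.
apply: eq_is_derive (is_derive_primitive c2 x0 xl) => // y; by rewrite mxE.
Qed.

Lemma const_of_derive0 (l : R) (f : R -> R) : 0 < l -> {within `[0, l], continuous f} ->
  (forall x, 0 < x < l -> is_derive x 1 f 0) -> f l = f 0.
Proof.
move=> l0 cf fd; have fd' x : x \in `]0, l[ -> is_derive x 1 f 0.
  by rewrite in_itv/=; exact: fd.
have [x _] := @MVT R f (fun _ => 0) 0 l l0 fd' cf.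
by rewrite mul0r => /eqP; rewrite subr_eq0 => /eqP.
Qed.

Lemma mx_const_of_der0 m n (l : R) (F : R -> 'M[C]_(m, n)) : 0 < l -> mxcont 0 l F ->
  (forall x, 0 < x < l -> mxder F x 0) -> F l = F 0.
Proof.
move=> l0 Fc Fd; apply/matrixP => i j; have [c1 c2] := Fc i j; apply: ceqP.
  by apply: (const_of_derive0 l0 c1) => x /Fd /(_ i j); rewrite mxE => -[].
by apply: (const_of_derive0 l0 c2) => x /Fd /(_ i j); rewrite mxE => -[].
Qed.

Lemma mxadj_mul m n q (A : 'M[C]_(m, n)) (B : 'M[C]_(n, q)) :
  mxadj (A *m B) = mxadj B *m mxadj A.
Proof. by rewrite /mxadj map_mxM trmx_mul. Qed.

Lemma mxadj_scale m n c (A : 'M[C]_(m, n)) : mxadj (c *: A) = conjc c *: mxadj A.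
Proof. by apply/matrixP => i j; rewrite !mxE rmorphM. Qed.

Lemma mxadjK m n (A : 'M[C]_(m, n)) : mxadj (mxadj A) = A.
Proof. by apply/matrixP => i j; rewrite !mxE conjcK. Qed.

Lemma mxadj1 n : mxadj (1%:M : 'M[C]_n) = 1%:M.
Proof. by rewrite /mxadj map_mx1 trmx1. Qed.

Lemma mxadj_J p : mxadj (Jmx R p) = Jmx R p.
Proof.
by rewrite /mxadj /Jmx map_block_mx tr_block_mx !map_mx1 !map_mx0 !trmx1 !trmx0.
Qed.

Lemma JJ p : Jmx R p *m Jmx R p = 1%:M.
Proof.
by rewrite /Jmx mulmx_block !mul0mx !mulmx0 !mul1mx !add0r !addr0 -scalar_mx_block.
Qed.

Lemma conjcM (x y : C) : conjc (x * y) = conjc x * conjc y.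
Proof. by rewrite rmorphM. Qed.

Lemma iC_conj : conjc (iC R) = - iC R.
Proof. by apply: ceqP; rewrite ?cre_conj ?cim_conj ?creN ?cimN /iC /cre /cim/= ?oppr0. Qed.

(** Since [J] is self-adjoint with square 1 and [H] is self-adjoint, the derivative of the left
    factor contributes [- i lam] times [W] adjoint, [H], [Y], and that of the right factor the
    opposite. Conjugating [lam] in the equation for [W] is what makes them cancel. *)
Lemma lagrange_identity p n (l : R) (lam : C) (b : R -> 'M[C]_(p, p + p))
    (W : R -> 'M[C]_(p + p)) (Y : R -> 'M[C]_(p + p, n)) : 0 < l ->
  mxcont 0 l W -> mxcont 0 l Y ->
  (forall x, 0 < x < l -> mxder W x
     ((iC R * conjc lam) *: (Jmx R p *m (mxadj (b x) *m b x)) *m W x)) ->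
  (forall x, 0 < x < l -> mxder Y x
     ((iC R * lam) *: (Jmx R p *m (mxadj (b x) *m b x)) *m Y x)) ->
  mxadj (W l) *m (Jmx R p *m Y l) = mxadj (W 0) *m (Jmx R p *m Y 0).
Proof.
move=> l0 Wc Yc Wd Yd.
apply: (@mx_const_of_der0 _ _ l (fun x => mxadj (W x) *m (Jmx R p *m Y x))) => //.
  by apply: mxcont_mul; [exact: mxcont_adj|apply: mxcont_mul => //; exact: mxcont_cst].
move=> x xl.
have := mxder_mul (mxder_adj (Wd x xl)) (mxder_mul (mxder_cst (Jmx R p) x) (Yd x xl)).
congr (mxder _ _ _); rewrite mul0mx add0r.
rewrite mxadj_mul mxadj_scale conjcM conjcK iC_conj !mxadj_mul mxadjK mxadj_J.
rewrite -!scalemxAl -!scalemxAr -!scalemxAl -!mulmxA.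
rewrite [Jmx R p *m (Jmx R p *m Y x)]mulmxA JJ mul1mx.
rewrite [Jmx R p *m (Jmx R p *m _)]mulmxA JJ mul1mx.
by rewrite -scalerDl mulNr addNr scale0r.
Qed.

Lemma cintmx_point m n (a : R) (G : R -> 'M[C]_(m, n)) : cintmx a a G = 0.
Proof.
apply/matrixP => i j; rewrite !mxE; congr Complex;
by rewrite set_itv1 Rintegral_set1.
Qed.

Lemma mul_col1 m n (A : 'M[C]_(m, n)) k : A *m col k 1%:M = col k A.
Proof. by rewrite !colE mul1mx. Qed.

Lemma colfnE p n (b : R -> 'M[C]_(p, n)) k x : colfn b k x = b x *m col k 1%:M.
Proof. by rewrite mul_col1. Qed.

Lemma mxcont_colfn p n a b (G : R -> 'M[C]_(p, n)) k : mxcont a b G -> mxcont a b (colfn G k).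
Proof.
move=> Gc i j; apply: eq_ccont (Gc i k) => x _; by rewrite mxE.
Qed.

Lemma canonical_resolvent p (r l : R) (lam : C) (b : R -> 'M[C]_(p, p + p))
    (W : R -> C -> 'M[C]_(p + p)) (g : fn R p) (k : 'I_(p + p)) : 0 < l -> l <= r ->
  mxcont 0 r b -> lam != 0 ->
  (forall lam, W 0 lam = 1%:M) ->
  (forall lam, deriv_on r (fun x => W x lam)
     (fun x => (iC R * lam) *: (Jmx R p *m (mxadj (b x) *m b x)) *m W x lam)) ->
  inL2 l g -> aeeq l (fun x => Kop b g x - lam^-1 *: g x) (colfn b k) ->
  col k (W l lam) =
    col k 1%:M - iC R *: (Jmx R p *m cintmx 0 l (fun x => mxadj (b x) *m g x)).
Proof.
move=> l0 lr bc0 lam0 W0 Wd gL Kg.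
have sub m n (G : R -> 'M[C]_(m, n)) : mxcont 0 r G -> mxcont 0 l G.
  by move=> Gc i j; exact: ccont_sub (Gc i j).
have bc := sub _ _ _ bc0.
have Wc lam' : mxcont 0 l (fun x => W x lam') by apply: sub; exact: deriv_on_cont (Wd lam').
have gi := inL2_mxintg gL.
have bgi : mxintg 0 l (fun x => mxadj (b x) *m g x).
  by apply: mxintg_mul => //; exact: mxcont_adj.
pose y x := col k 1%:M + (- iC R) *: (Jmx R p *m cintmx 0 x (fun x => mxadj (b x) *m g x)).
have mxcontD m n (F G : R -> 'M[C]_(m, n)) : mxcont 0 l F -> mxcont 0 l G ->
    mxcont 0 l (fun x => F x + G x).
  move=> Fc Gc i j; apply: eq_ccont (ccontD (Fc i j) (Gc i j)) => x _; by rewrite mxE.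
have yc : mxcont 0 l y.
  apply: mxcontD; first exact: mxcont_cst.
  apply: mxcont_scale; apply: mxcont_mul; first exact: mxcont_cst.
  by apply: mxcont_primitive => //; exact: ltW.
have bbyc : mxcont 0 l (fun x => mxadj (b x) *m (b x *m y x)).
  by apply: mxcont_mul; [exact: mxcont_adj|exact: mxcont_mul].
have bbyi : mxintg 0 l (fun x => mxadj (b x) *m (b x *m y x)).
  by move=> i j; exact: ccont_intg.
have gy : aeeq l g (fun x => - lam *: (b x *m y x)).
  apply: ae_imp Kg => x h /h {h}; rewrite colfnE => e.
  have e2 : b x *m y x = - (lam^-1 *: g x).
    rewrite /y mulmxDr -e /Kop -scalemxAr mulmxA scaleNr addrAC subrr add0r //.
  by rewrite e2 scalerN scaleNr opprK scalerA mulfV// scale1r.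
(* [g] is known only almost everywhere, but [y] contains it under an integral, so the substitution
   holds at every point and makes [y] a primitive of a continuous function. *)
have yE x : 0 <= x <= l -> y x = col k 1%:M + (iC R * lam) *:
    (Jmx R p *m cintmx 0 x (fun x => mxadj (b x) *m (b x *m y x))).
  move=> /andP[x0 xl]; rewrite /y; congr (_ + _).
  have -> : cintmx 0 x (fun x => mxadj (b x) *m g x) =
      cintmx 0 x (fun x => - lam *: (mxadj (b x) *m (b x *m y x))).
    apply/matrixP => i j; rewrite !mxE; apply: ae_eq_cint.
    - exact: cintg_sub (bgi i j).
    - have := cintg_sub (lexx 0) xl (cintgZ (- lam) (bbyi i j)).
      by apply: eq_cintg => t _; rewrite [RHS]mxE.
    - apply: ae_imp gy => t h /andP[t0 tx]; rewrite h ?t0 ?(le_trans tx)//.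
      by rewrite -scalemxAr.
  rewrite -cintmx_scale; last by apply: mxintg_sub bbyi.
  by rewrite -scalemxAr scalerA mulrNN.
have yd x : 0 < x < l ->
    mxder y x ((iC R * lam) *: (Jmx R p *m (mxadj (b x) *m b x)) *m y x).
  move=> /andP[x0 xl].
  (* The right-hand side of [yE] as a function on the whole line; it agrees with [y] on [[0, l]],
     hence near an interior point. *)
  pose z x := col k 1%:M + ((iC R * lam) *: Jmx R p) *m
     cintmx 0 x (fun x => mxadj (b x) *m (b x *m y x)).
  have zd : mxder z x ((iC R * lam) *: (Jmx R p *m (mxadj (b x) *m b x)) *m y x).
    have := mxderD (mxder_cst (col k 1%:M) x)
      (mxder_mul (mxder_cst ((iC R * lam) *: Jmx R p) x) (mxder_primitive bbyc x0 xl)).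
    by congr (mxder _ _ _); rewrite mul0mx !add0r -!scalemxAl !mulmxA.
  have zy : \forall t \near x, z t = y t.
    have : \forall t \near x, t \in `]0, l[ by apply: near_in_itvoo; rewrite in_itv/= x0.
    apply: filterS => t; rewrite in_itv/= => /andP[t0 tl].
    by rewrite yE ?(ltW t0) ?(ltW tl)// /z -scalemxAl.
  move=> i j; have [d1 d2] := zd i j.
  have near_der (f h : R -> R) d : (\forall t \near x, f t = h t) ->
      is_derive x 1 f d -> is_derive x 1 h d.
    move=> fh [fd <-]; split; first exact: near_eq_derivable fd.
    by apply/esym; apply: near_eq_derive.
  by split; [apply: near_der d1|apply: near_der d2]; apply: filterS zy => t ->.
have Wdx lam' x : 0 < x < l -> mxder (fun x => W x lam') x
    ((iC R * lam') *: (Jmx R p *m (mxadj (b x) *m b x)) *m W x lam').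
  move=> /andP[x0 xl]; apply: (deriv_on_mxder (Wd lam')).
  by rewrite x0 (lt_le_trans xl).
(* Both [W l lam] applied to [e_k] and [y l] are sent to [J e_k] by the same matrix [V]; [L1] also
   shows that [V] is invertible, which forces them to be equal. *)
have L1 := lagrange_identity l0 (Wc (conjc lam)) (Wc lam) (Wdx (conjc lam)) (Wdx lam).
have L2 := lagrange_identity l0 (Wc (conjc lam)) yc (Wdx (conjc lam)) yd.
have y0 : y 0 = col k 1%:M by rewrite /y cintmx_point mulmx0 scaler0 addr0.
rewrite !W0 mxadj1 !mul1mx in L1 L2; rewrite y0 in L2.
set V := mxadj (W l (conjc lam)) *m Jmx R p.
have VU : V \in unitmx.
  have : V *m (W l lam *m Jmx R p) = 1%:M.
    by rewrite mulmxA -[V *m _]mulmxA L1 mulmx1 JJ.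
  by case/mulmx1_unit.
suff : W l lam *m col k 1%:M = y l by rewrite mul_col1 /y scaleNr.
apply: (can_inj (mulKmx VU)).
by rewrite mulmxA /V -!mulmxA L2 [Jmx R p *m (_ *m _)]mulmxA [mxadj _ *m _]mulmxA L1 mulmx1.
Qed.

End Canonical.

(** * Restriction, extension by zero and inner products modulo null sets *)

Section Operators.
Variable R : realType.
Local Notation C := (R[i]).
Local Notation mu := (@lebesgue_measure R).
Local Notation intg a b f := (mu.-integrable `[a, b] (EFin \o f)).

Lemma aeeq_sym p l (f g : fn R p) : aeeq l f g -> aeeq l g f.
Proof. by apply: ae_imp => x h /h ->. Qed.

Lemma aeeq_trans p l (f g h : fn R p) : aeeq l f g -> aeeq l g h -> aeeq l f h.
Proof. by move=> fg gh; apply: ae_imp (ae_and fg gh) => x [h1 h2] xl; rewrite h1// h2. Qed.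

Lemma aeeq_sub p l r (f g : fn R p) : l <= r -> aeeq r f g -> aeeq l f g.
Proof. by move=> lr; apply: ae_imp => x h /andP[x0 xl]; rewrite h// x0 (le_trans xl). Qed.

Lemma aeeq_pointwise p l (f g : fn R p) : (forall x, 0 <= x <= l -> f x = g x) -> aeeq l f g.
Proof. by move=> fg; apply: aeW. Qed.

Lemma extE p l (f : fn R p) x : 0 <= x <= l -> ext l f x = f x.
Proof. by rewrite /ext => ->. Qed.

Lemma ext_out p l (f : fn R p) x : l < x -> ext l f x = 0.
Proof. by move=> lx; rewrite /ext [x <= l]leNgt lx andbF. Qed.

Lemma inL2_sub p l r (f : fn R p) : l <= r -> inL2 r f -> inL2 l f.
Proof. by move=> lr fL i; exact: L2c_sub lr (fL i). Qed.

Lemma inL2_ext p l r (f : fn R p) : l <= r -> inL2 l f -> inL2 r (ext l f).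
Proof.
move=> lr fL i; have := L2c_ext lr (fL i); congr (L2c _ _).
by apply/funext => x; rewrite /ext; case: ifP => // _; rewrite mxE.
Qed.

Lemma L2c_lin l (a : C) (f g : R -> C) : L2c l f -> L2c l g -> L2c l (fun x => a * f x + g x).
Proof.
move=> fL gL; have afi := L2c_mul (L2c_cst l a) fL.
have [s1 s2] := cintgD afi (L2c_intg gL).
split; first exact: intg_measurable s1.
split; first exact: intg_measurable s2.
have [_ [_ f3]] := fL; have [_ [_ g3]] := gL.
have d : intg 0 l (fun x => 2 * (cabs2 a * cabs2 (f x)) + 2 * cabs2 (g x)).
  by apply: intgD; apply: intgZ => //; exact: intgZ.
apply: (intg_le (f := fun x => cabs2 (a * f x + g x))) d.
  by apply: measurable_funD; apply: measurable_funX; [exact: intg_measurable s1|exact: intg_measurable s2].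
move=> x _; rewrite ger0_norm ?cabs2_ge0//.
rewrite /cabs2 creD cimD creM cimM.
move: (cre a) (cim a) (cre (f x)) (cim (f x)) (cre (g x)) (cim (g x)) => a1 a2 f1 f2 h1 h2.
have := sqr_ge0 (a1 * f1 - a2 * f2 - h1); have := sqr_ge0 (a1 * f2 + a2 * f1 - h2).
by lra.
Qed.

Lemma inL2_lin p l (a : C) (f g : fn R p) : inL2 l f -> inL2 l g ->
  inL2 l (fun x => a *: f x + g x).
Proof.
move=> fL gL i; have := L2c_lin a (fL i) (gL i); congr (L2c _ _).
by apply/funext => x; rewrite !mxE.
Qed.

Lemma Eop_ext p (u : R -> 'M[C]_p) b Ek l (f : fn R p) x : 0 <= x <= l ->
  Eop u b Ek (ext l f) x = Eop u b Ek f x.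
Proof.
move=> /andP[x0 xl]; rewrite /Eop extE ?x0//; congr (_ + _).
by apply: eq_cintmx => t /andP[t0 tx]; rewrite extE// t0 (le_trans tx).
Qed.

(** Triangularity of [E] modulo null sets. Boundedness only gives compatibility with almost
    everywhere equality on all of [[0, r]], so both functions are first cut off at [l]; at points of
    [[0, l]] the formula for [E] does not see the cut. *)
Lemma Eop_local p (u : R -> 'M[C]_p) b Ek l r (f g : fn R p) : l <= r ->
  bounded_op r (Eop u b Ek) -> inL2 r f -> inL2 r g -> aeeq l f g ->
  aeeq l (Eop u b Ek f) (Eop u b Ek g).
Proof.
move=> lr [_ [Eae _]] fL gL fg.
have fg' : aeeq r (ext l f) (ext l g).
  by apply: ae_imp fg => x h _; rewrite /ext; case: ifP => // /h ->.
have := Eae _ _ (inL2_ext lr (inL2_sub lr fL)) (inL2_ext lr (inL2_sub lr gL)) fg'.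
move=> /(aeeq_sub lr); apply: ae_imp => x h xl; have := h xl.
by rewrite !Eop_ext.
Qed.

Lemma ip_integrandE p (f g : 'cV[C]_p) : (mxadj g *m f) 0 0 = \sum_i conjc (g i 0) * f i 0.
Proof. by rewrite mxE; apply: eq_bigr => i _; rewrite !mxE. Qed.

Lemma ip_intg p l (f g : fn R p) : inL2 l f -> inL2 l g ->
  cintg 0 l (fun x => (mxadj (g x) *m f x) 0 0).
Proof.
move=> fL gL; have [h _] := cintg_sum (fun i => L2c_mul (L2c_conj (gL i)) (fL i)).
by apply: eq_cintg h => x _; rewrite ip_integrandE.
Qed.

Lemma ip_conj p l (f g : fn R p) : inL2 l f -> inL2 l g -> ip l f g = conjc (ip l g f).
Proof.
move=> fL gL; rewrite /ip -cint_conj; last exact: ip_intg.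
apply: eq_cint => x _; rewrite !ip_integrandE rmorph_sum/=; apply: eq_bigr => i _.
by rewrite conjcM conjcK mulrC.
Qed.

Lemma ip_ae p l (f f' g g' : fn R p) : inL2 l f -> inL2 l f' -> inL2 l g -> inL2 l g' ->
  aeeq l f f' -> aeeq l g g' -> ip l f g = ip l f' g'.
Proof.
move=> fL fL' gL gL' ff gg; apply: ae_eq_cint; [exact: ip_intg|exact: ip_intg|].
by apply: ae_imp (ae_and ff gg) => x [h1 h2] xl; rewrite h1// h2.
Qed.

Lemma cint_restrict l r (f g : R -> C) : l <= r -> (forall x, 0 <= x <= l -> f x = g x) ->
  (forall x, l < x <= r -> f x = 0) -> cint 0 r f = cint 0 l g.
Proof.
move=> lr fg f0.
have h (F : C -> R) : F 0 = 0 ->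
    \int[mu]_(x in `[0, r]) F (f x) = \int[mu]_(x in `[0, l]) F (g x).
  move=> F0; have -> : `[0, l]%classic = `[0, r] `&` `[0, l] :> set R.
    by apply/esym/setIidPr; apply: subset_itvl; rewrite bnd_simp.
  rewrite Rintegral_mkcondr; apply: eq_Rintegral => x; rewrite inE/= in_itv/= => /andP[x0 xr].
  rewrite patchE; case: ifPn => [|]; rewrite ?inE ?notin_setE/= in_itv/=.
    by move=> /fg ->.
  rewrite x0/= => /negP; rewrite -ltNge => lx; rewrite f0 ?lx// F0//.
by congr Complex; exact: h.
Qed.

Lemma ip_extl p l r (f g : fn R p) : l <= r -> ip r (ext l f) g = ip l f g.
Proof.
move=> lr; apply: cint_restrict => // x; first by move=> xl; rewrite extE.
by move=> /andP[lx _]; rewrite ext_out// mulmx0 mxE.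
Qed.

Lemma mxadj0 m n : mxadj (0 : 'M[C]_(m, n)) = 0.
Proof. by rewrite /mxadj map_mx0 trmx0. Qed.

Lemma ip_extr p l r (f g : fn R p) : l <= r -> ip r f (ext l g) = ip l f g.
Proof.
move=> lr; apply: cint_restrict => // x; first by move=> xl; rewrite extE.
by move=> /andP[lx _]; rewrite ext_out// mxadj0 mul0mx mxE.
Qed.

End Operators.

(** * The fundamental solution as a transfer matrix function *)

Unset Implicit Arguments.

Theorem theorem2p7 (R : realType) (p : nat) (r : R)
  (* beta = [beta_1 beta_2] in U^{p x 2p}[0,r], with derivative beta' *)
  (beta beta' : R -> 'M[R[i]]_(p, p + p))
  (u u' : R -> 'M[R[i]]_p)
  (Ek : R -> R -> 'M[R[i]]_p)
  (Einv Estar EstarInv : fn R p -> fn R p)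
  (W : R -> R[i] -> 'M[R[i]]_(p + p)) :
  0 < r ->
  classU r beta beta' ->
  (forall x, 0 <= x <= r -> beta x *m Jmx R p *m mxadj (beta x) = 0) ->
  (forall x, 0 <= x <= r -> beta' x *m Jmx R p *m mxadj (beta x) = iC R *: 1%:M) ->
  blk2 beta 0 \in unitmx ->
  (* u unitary-valued, in U^{p x p}[0,r], u(0) = I *)
  classU r u u' ->
  (forall x, 0 <= x <= r -> u x *m mxadj (u x) = 1%:M) ->
  u 0 = 1%:M ->
  (* the kernel integrals defining E make sense *)
  kernel_ok r Ek ->
  (* E bounded with bounded inverse Einv *)
  bounded_op r (Eop u beta Ek) ->
  bounded_op r Einv ->
  inverse_on r (Eop u beta Ek) Einv ->
  (* K = E A E^{-1} *)
  (forall f, inL2 r f -> aeeq r (Kop beta f) (Eop u beta Ek (Aop (Einv f)))) ->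
  (* E^{-1} beta_2 = I_p, columnwise *)
  (forall k : 'I_p, aeeq r (Einv (colfn (blk2 beta) k)) (fun _ => col k 1%:M)) ->
  (* Estar = adjoint of E, EstarInv = its inverse *)
  adjoint_on r (Eop u beta Ek) Estar ->
  inverse_on r Estar EstarInv ->
  (* W is the fundamental solution of w' = i lambda J H w, H = beta^* beta, W(0) = I *)
  (forall lam, W 0 lam = 1%:M) ->
  (forall lam, deriv_on r (fun x => W x lam)
     (fun x => (iC R * lam) *: (Jmx R p *m (mxadj (beta x) *m beta x)) *m W x lam)) ->
  forall (l : R) (lam : R[i]), 0 < l <= r -> lam != 0 ->
  (* S = E^{-1} (adjoint E)^{-1}, Pi = E^{-1} beta (column k);
     Sinv = S_l^{-1}, Rinv = (A_l - lam^{-1} I)^{-1} on L_2^p(0,l) *)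
  let S := fun f => Einv (EstarInv f) in
  let Pi := fun k : 'I_(p + p) => Einv (colfn beta k) in
  forall Sinv Rinv : fn R p -> fn R p,
  inverse_on l (fun f => S (ext l f)) Sinv ->
  inverse_on l (fun f x => Aop (ext l f) x - lam^-1 *: f x) Rinv ->
  W l lam = 1%:M - iC R *: (Jmx R p *m
     \matrix_(i, k) (cintmx 0 l
        (fun x => mxadj (colsmx Pi x) *m Sinv (Rinv (Pi k)) x)) i 0).
Proof.
move=> r0 bU bJb b1Jb _ _ _ _ _ Ebd Eibd [EiL [Eiae EEi]] KE _ [EsL Eadj] [EsiL [_ EsEsi]] W0 Wd.
move=> l lam /andP[l0 lr] lam0 S Pi Sinv Rinv [SiL [_ SSi]] [RiL [_ RRi]].
have r0' := ltW r0; have l0' := ltW l0.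
set E := Eop u beta Ek in Ebd EEi KE Eadj *.
have [EL [Eae [Elin _]]] := Ebd.
have [_ [_ [Eilin _]]] := Eibd.
have bc := deriv_on_cont bU.1.
have bL k : inL2 r (colfn beta k) by apply: mxcont_inL2; exact: mxcont_colfn.
have EiK f : inL2 r f -> aeeq r (Einv (Kop beta f)) (Aop (Einv f)).
  move=> fL; have AL : inL2 r (Aop (Einv f)) by apply: Aop_inL2 => //; exact: EiL.
  have KL : inL2 r (Kop beta f) by apply: mxcont_inL2; exact: Kop_cont.
  exact: aeeq_trans (Eiae _ _ KL (EL _ AL) (KE f fL)) (EEi _ AL).2.
(* The tail [rest] of a column of [beta] vanishes on [[0, l]] and is bounded by continuity, so
   [causal_vanish] applies; [B + 1] gives a strictly positive bound. *)
have causal j : aeeq l (Einv (colfn beta j)) (Einv (ext l (colfn beta j))).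
  have eL : inL2 r (ext l (colfn beta j)) by apply: inL2_ext => //; exact: inL2_sub (bL j).
  pose rest x := -1 *: ext l (colfn beta j) x + colfn beta j x.
  have restL : inL2 r rest by exact: inL2_lin.
  have [B B0 HB] := mxcont_bound (mxcont_colfn j bc).
  have rest0 x : 0 <= x <= l -> rest x = 0 by move=> xl; rewrite /rest extE// scaleN1r addNr.
  have restB x : l <= x <= r -> forall i, cbnd (rest x i 0) (B + 1).
    move=> /andP[lx xr] i; have [xl|xl] := leP x l.
      rewrite rest0 ?(le_trans l0' lx)// mxE; split; rewrite ?cre0 ?cim0 normr0; lra.
    rewrite /rest ext_out// scaler0 add0r.
    by apply: cbnd_le (HB x _ i 0); [lra|rewrite (le_trans l0' lx)].
  have v : aeeq l (Einv rest) (fun _ => 0).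
    by apply: (@causal_vanish R p r l beta beta' Einv rest (B + 1)) => //; lra.
  have := Eilin 1 _ _ restL eL.
  have -> : (fun x => 1 *: rest x + ext l (colfn beta j) x) = colfn beta j.
    by apply/funext => x; rewrite /rest scale1r scaleN1r addrAC addNr add0r.
  move=> /(aeeq_sub lr) h; apply: ae_imp (ae_and v h) => x [v1 h1] xl.
  by rewrite h1// v1// scaler0 add0r.
have key k : col k (W l lam) = col k 1%:M - iC R *: (Jmx R p *m
    cintmx 0 l (fun x => mxadj (colsmx Pi x) *m Sinv (Rinv (Pi k)) x)).
  (* no *)
  have PiL j : inL2 r (Pi j) by exact: EiL.
  pose q := Rinv (Pi k); have qL : inL2 l q by apply: RiL; exact: inL2_sub (PiL k).
  pose eq := ext l q; have eqL : inL2 r eq by exact: inL2_ext.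
  pose g := E eq; have gL : inL2 r g by exact: EL.
  have AeqL : inL2 r (Aop eq) by exact: Aop_inL2.
  have Kg : aeeq l (fun x => Kop beta g x - lam^-1 *: g x) (colfn beta k).
    have EA : aeeq r (E (Aop eq)) (Kop beta g).
      apply: aeeq_sym; apply: aeeq_trans (KE g gL) _.
      have EigL : inL2 r (Einv g) by exact: EiL.
      apply: Eae => //; first exact: Aop_inL2.
      by apply: aeeq_pointwise; apply: Aop_ae => //; exact: (EEi _ eqL).2.
    have res : aeeq l (fun x => - lam^-1 *: eq x + Aop eq x) (Pi k).
      apply: ae_imp (RRi _ (inL2_sub lr (PiL k))).1 => x h xl.
      by rewrite -h// /eq extE// scaleNr addrC.
    have e1 := Eop_local lr Ebd (inL2_lin _ eqL AeqL) (PiL k) res.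
    have e2 := aeeq_sub lr (Elin (- lam^-1) _ _ eqL AeqL).
    have e3 := aeeq_sub lr EA.
    have e4 := aeeq_sub lr (EEi _ (bL k)).1.
    apply: ae_imp (ae_and (ae_and e1 e2) (ae_and e3 e4)) => x [[h1 h2] [h3 h4]] xl.
    rewrite -h4//; transitivity (E (fun x => - lam^-1 *: eq x + Aop eq x) x); last exact: h1.
    by rewrite h2// h3// scaleNr addrC.
  rewrite (canonical_resolvent l0 lr bc lam0 W0 Wd (inL2_sub lr gL) Kg).
  congr (_ - _ *: (_ *m _)); apply/matrixP => j i; rewrite (ord1 i) !mxE.
  pose s := Sinv q; have sL : inL2 l s by exact: SiL.
  pose es := ext l s; have esL : inL2 r es by exact: inL2_ext.
  pose v := EstarInv es; have vL : inL2 r v by exact: EsiL.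
  pose w := Einv (ext l (colfn beta j)).
  have eb : inL2 r (ext l (colfn beta j)) by apply: inL2_ext => //; exact: inL2_sub (bL j).
  have wL : inL2 r w by exact: EiL.
  have vg : aeeq l v g.
    apply: aeeq_trans (aeeq_sym (aeeq_sub lr (EEi v vL).1)) _.
    apply: (Eop_local lr Ebd) => //; first exact: EiL.
    apply: aeeq_trans (SSi q qL).1 _.
    by apply: aeeq_pointwise => x xl; rewrite /eq extE.
  have sub f : inL2 r f -> inL2 l f := @inL2_sub R p l r f lr.
  transitivity (ip l g (colfn beta j)).
    by apply: eq_cint => x _; rewrite !mxE; apply: eq_bigr => i' _; rewrite !mxE.
  transitivity (ip l s (Pi j)); last first.
    by apply: eq_cint => x _; rewrite !mxE; apply: eq_bigr => i' _; rewrite !mxE.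
  have st (f : fn R p) : aeeq l f f by apply: aeeq_pointwise.
  have st' (f : fn R p) : aeeq r f f by apply: aeeq_pointwise.
  rewrite (ip_ae sL sL (sub _ (PiL j)) (sub _ wL) (st s) (causal j)).
  rewrite -(ip_extl s w lr) (ip_conj esL wL).
  rewrite (ip_ae wL wL esL (EsL _ vL) (st' w) (aeeq_sym (EsEsi _ esL).1)).
  rewrite -Eadj// (ip_ae (EL _ wL) eb vL vL (EEi _ eb).1 (st' v)).
  rewrite -(ip_conj vL eb) (ip_extr v (colfn beta j) lr).
  by apply: ip_ae => //; [exact: sub|exact: sub|exact: sub|exact: sub|exact: aeeq_sym].
apply/matrixP => i k; have /matrixP/(_ i 0) := key k; rewrite [LHS]mxE => ->.
rewrite [LHS]mxE [RHS]mxE; congr (_ + _); first by rewrite mxE.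
rewrite [LHS]mxE [RHS]mxE; congr (- _); rewrite [LHS]mxE [RHS]mxE; congr (_ * _).
by rewrite [LHS]mxE [RHS]mxE; apply: eq_bigr => j _; rewrite [X in _ = _ * X]mxE.
Qed.
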